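(* Let $\alpha,\beta,\gamma\in\Bbbk^n$ and $\mathcal H=\mathcal H(\alpha,\beta,\gamma)$. The following are equivalent: (1) $\beta_i\neq0$ for all $i\in Q_0$; (2) $\mathcal H$ is right noetherian; (2') $\mathcal H$ is left noetherian; (3) for every $i\in Q_0$, $\Bbbk[u_id_i,\,d_{i-1}u_{i-1}]$ is a polynomial ring in two variables; (4) $\mathcal H$ is a piecewise domain.
   Context: $\Bbbk$ is an algebraically closed field of characteristic zero. Fix $n\ge1$; indices mod $n$, $Q_0=\{0,\dots,n-1\}$. $Q$ is the quiver with vertices $Q_0$ and arrows $u_i:i\to i+1$, $d_i:i+1\to i$; paths are written left to right (so $u_id_i$ and $d_{i-1}u_{i-1}$ are loops at $i$), $e_i$ is the trivial path at $i$. $\mathcal H(\alpha,\beta,\gamma)$ is $\Bbbk Q$ modulo the relations $d_{i-1}u_{i-1}u_i=\alpha_iu_id_iu_i+\beta_iu_iu_{i+1}d_{i+1}+\gamma_iu_i$ and $d_id_{i-1}u_{i-1}=\alpha_id_iu_id_i+\beta_iu_{i+1}d_{i+1}d_i+\gamma_id_i$ for all $i\in Q_0$. $\Bbbk[u_id_i,d_{i-1}u_{i-1}]$ denotes the subalgebra of $e_i\mathcal He_i$ generated by $e_i$, $u_id_i$, $d_{i-1}u_{i-1}$. A ring with complete set of orthogonal idempotents $e_0,\dots,e_{n-1}$ is a piecewise domain if $ab=0$ implies $a=0$ or $b=0$ whenever $a\in e_iSe_k$, $b\in e_kSe_j$. *)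

(* Defs.v *)
From HB Require Import structures.
From mathcomp Require Import all_boot all_order all_algebra.
Set Implicit Arguments. Unset Strict Implicit. Unset Printing Implicit Defensive.
Import Order.TTheory GRing.Theory.
Local Open Scope ring_scope.

(* The quiver Q with vertices 0..n-1 (indices mod n), arrows u_i : i -> i+1   *)
(* and d_i : i+1 -> i.  Every vertex j has exactly one outgoing "up" arrow    *)
(* (u_j) and one outgoing "down" arrow (d_(j-1)), so a path is determined by  *)
(* its start vertex and a word in {up = true, down = false}; paths are read   *)
(* left to right.                                                            *)

Definition qpath := (nat * seq bool)%type.

Definition vup (n i : nat) : nat := (i.+1 %% n)%N.
Definition vdown (n i : nat) : nat := ((i + n.-1) %% n)%N.

Definition tgt (n : nat) (p : qpath) : nat :=
  foldl (fun v (b : bool) => if b then vup n v else vdown n v) p.1 p.2.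

Section PathAlgebra.
Variables (k : fieldType) (n : nat).

(* k-valued functions on paths; the path algebra kQ consists of those with   *)
(* finite support on the paths starting at a vertex of Q_0.                  *)
Definition qfun := qpath -> k.

Definition fin_supp (f : qfun) : Prop :=
  exists N : nat, forall p : qpath, (n <= p.1)%N || (N < size p.2)%N -> f p = 0.

Definition qzero : qfun := fun _ => 0.
Definition qadd (f g : qfun) : qfun := fun p => f p + g p.
Definition qopp (f : qfun) : qfun := fun p => - f p.
Definition qscale (c : k) (f : qfun) : qfun := fun p => c * f p.

(* product = k-bilinear extension of concatenation of paths (0 when the    *)
(* paths are not composable): (f g)(p) = sum over p = p1 p2 of f(p1) g(p2)  *)
Definition qmul (f g : qfun) : qfun := fun p =>
  \sum_(j < (size p.2).+1)
     f (p.1, take j p.2) * g (tgt n (p.1, take j p.2), drop j p.2).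

Definition qbasis (q : qpath) : qfun := fun p => (p == q)%:R.

Definition qe (i : nat) : qfun := qbasis (i, [::]).
Definition qu (i : nat) : qfun := qbasis (i, [:: true]).
Definition qd (i : nat) : qfun := qbasis (vup n i, [:: false]).

Definition qsum (fs : seq qfun) : qfun := foldr qadd qzero fs.

Definition qpow (i : nat) (x : qfun) (m : nat) : qfun := iter m (fun y => qmul y x) (qe i).

Variables (alpha beta gamma : 'I_n -> k).

Definition rel1 (i : 'I_n) : qfun :=
  let i' := nat_of_ord i in
  qadd (qmul (qd (vdown n i')) (qmul (qu (vdown n i')) (qu i')))
   (qopp (qadd (qscale (alpha i) (qmul (qu i') (qmul (qd i') (qu i'))))
     (qadd (qscale (beta i) (qmul (qu i') (qmul (qu (vup n i')) (qd (vup n i')))))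
           (qscale (gamma i) (qu i'))))).

Definition rel2 (i : 'I_n) : qfun :=
  let i' := nat_of_ord i in
  qadd (qmul (qd i') (qmul (qd (vdown n i')) (qu (vdown n i'))))
   (qopp (qadd (qscale (alpha i) (qmul (qd i') (qmul (qu i') (qd i'))))
     (qadd (qscale (beta i) (qmul (qu (vup n i')) (qmul (qd (vup n i')) (qd i'))))
           (qscale (gamma i) (qd i'))))).

(* The two-sided ideal I of kQ generated by the relations; H = kQ / I.      *)
Inductive inI : qfun -> Prop :=
  | inI0 : inI qzero
  | inI_gen1 (a b : qfun) (i : 'I_n) :
      fin_supp a -> fin_supp b -> inI (qmul a (qmul (rel1 i) b))
  | inI_gen2 (a b : qfun) (i : 'I_n) :
      fin_supp a -> fin_supp b -> inI (qmul a (qmul (rel2 i) b))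
  | inI_add (f g : qfun) : inI f -> inI g -> inI (qadd f g)
  | inI_ext (f g : qfun) : inI f -> (forall p, f p = g p) -> inI g.

(* Right (resp. left) ideals of H = kQ/I correspond to right (resp. left)  *)
(* ideals of kQ containing I (via the preimage); we describe them that way. *)
Definition right_ideal_over_I (J : qfun -> Prop) : Prop :=
  [/\ forall f, J f -> fin_supp f,
      forall f, fin_supp f -> inI f -> J f,
      forall f g, J f -> J g -> J (qadd f g)
    & forall f a, J f -> fin_supp a -> J (qmul f a)].

Definition left_ideal_over_I (J : qfun -> Prop) : Prop :=
  [/\ forall f, J f -> fin_supp f,
      forall f, fin_supp f -> inI f -> J f,
      forall f g, J f -> J g -> J (qadd f g)
    & forall f a, J f -> fin_supp a -> J (qmul a f)].

Definition H_right_noetherian : Prop :=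
  forall J, right_ideal_over_I J ->
    exists gs : seq qfun, (forall j, (j < size gs)%N -> J (nth qzero gs j)) /\
      forall f, J f -> exists as_ : seq qfun, size as_ = size gs /\
        (forall j, (j < size as_)%N -> fin_supp (nth qzero as_ j)) /\
        inI (qadd f (qopp (qsum [seq qmul (nth qzero gs j) (nth qzero as_ j) | j <- iota 0 (size gs)]))).

Definition H_left_noetherian : Prop :=
  forall J, left_ideal_over_I J ->
    exists gs : seq qfun, (forall j, (j < size gs)%N -> J (nth qzero gs j)) /\
      forall f, J f -> exists as_ : seq qfun, size as_ = size gs /\
        (forall j, (j < size as_)%N -> fin_supp (nth qzero as_ j)) /\
        inI (qadd f (qopp (qsum [seq qmul (nth qzero as_ j) (nth qzero gs j) | j <- iota 0 (size gs)]))).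

(* H is a piecewise domain w.r.t. e_0, ..., e_{n-1}: for a in e_i H e_l and *)
(* b in e_l H e_j, ab = 0 implies a = 0 or b = 0.  Elements of e_i H e_l are *)
(* the classes of e_i a e_l with a in kQ.                                    *)
Definition H_piecewise_domain : Prop :=
  forall (i l j : 'I_n) (a b : qfun), fin_supp a -> fin_supp b ->
    let a' := qmul (qe i) (qmul a (qe l)) in
    let b' := qmul (qe l) (qmul b (qe j)) in
    inI (qmul a' b') -> inI a' \/ inI b'.

(* k[x, y] ⊆ e_i H e_i (generated by e_i, x, y) is a polynomial ring in the *)
(* two variables x, y: x and y commute and the substitution map             *)
(* k[X,Y] -> e_i H e_i, X |-> x, Y |-> y, is injective.                     *)
Definition poly2_eval (i : nat) (x y : qfun) (P : {poly {poly k}}) : qfun :=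
  qsum [seq qsum [seq qscale (P`_a)`_b (qmul (qpow i x a) (qpow i y b))
                   | b <- iota 0 (size P`_a)] | a <- iota 0 (size P)].

Definition is_poly_ring2 (i : nat) (x y : qfun) : Prop :=
  inI (qadd (qmul x y) (qopp (qmul y x))) /\
  forall P : {poly {poly k}}, P != 0 -> ~ inI (poly2_eval i x y P).

End PathAlgebra.

(* Main.v *)
Require Import Defs.
From HB Require Import structures.
From mathcomp Require Import all_boot all_order all_algebra.
From mathcomp Require Import boolp zify ring.
Set Implicit Arguments. Unset Strict Implicit. Unset Printing Implicit Defensive.
Import Order.TTheory GRing.Theory.
Local Open Scope ring_scope.

(* Write U and D for the sums of the u_i and of the d_i, X = UD and Y = DU. The
   relations give XY = YX, and e_i H is spanned by the e_i X^p Y^q U^m and the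
   e_i X^p Y^q D^m once all beta_i are nonzero.

   A sequence lam indexed by the integers with
     lam a = alpha_a lam (a+1) + beta_a lam (a+2) + gamma_a
   makes H act on functions psi on the integers by (U psi) a = psi (a+1) and
   (D psi) a = lam a * psi (a-1), so that X and Y act by lam (a+1) and lam a.
   If no beta_i vanishes, the recurrence runs in both directions and lam can be
   taken in k[s,t] with every pair (lam (a+1), lam a) algebraically independent;
   so k[X,Y] is a polynomial ring at each vertex, and a nonzero element of e_i H
   has a leading term for the Z-grading with U of degree 1 and D of degree -1.
   Leading terms multiply without cancellation: H is a piecewise domain.

   In that case H is noetherian by a Groebner-type argument: right multiplication
   moves a leading monomial X^p Y^q U^m e_j to X^p' Y^q' U^m' e_j' whenever the
   exponents increase and the start vertex is unchanged, so Dickson's lemma gives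
   finitely many generators that remove every nonnegative degree in U; the same
   with D handles what is left. The left version is the right one for the
   opposite algebra.

   If beta_i = 0, then w = e_i (Y - alpha_i X - gamma_i) satisfies w U = 0, hence
   w X = 0 and H is not a piecewise domain. The action truncated at i, with lam
   vanishing above i and lam i = 1 + gamma_i, separates the elements U^m w and
   shows that the right ideal they generate needs infinitely many generators;
   similarly for the w D^m on the left. *)

(** * The path algebra *)

Section PathFunctions.
Variables (k : fieldType) (n0 : nat).
Local Notation n := n0.+1.
Implicit Types (f g h : qfun k) (w : seq bool).

Definition qstep (v : nat) (b : bool) : nat := if b then vup n v else vdown n v.

(** Left derivative of [f] along the arrow [b] out of [v]. The start vertex of the argument is
    ignored, so that a product evaluated at a nonempty path unfolds letter by letter. *)
Definition qres (v : nat) (b : bool) f : qfun k := fun p => f (v, b :: p.2).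

Lemma qmul_nil f g v : qmul n f g (v, [::]) = f (v, [::]) * g (v, [::]).
Proof. by rewrite /qmul /= big_ord_recl big_ord0 addr0. Qed.

Lemma qmul_cons f g v b w :
  qmul n f g (v, b :: w) =
  f (v, [::]) * g (v, b :: w) + qmul n (qres v b f) g (qstep v b, w).
Proof. by rewrite /qmul /= big_ord_recl. Qed.

Lemma qmul_congl f f' g v w :
  (forall w', f (v, w') = f' (v, w')) -> qmul n f g (v, w) = qmul n f' g (v, w).
Proof. by move=> E; apply: eq_bigr => j _; rewrite E. Qed.

Lemma qaddA f g h : qadd f (qadd g h) = qadd (qadd f g) h.
Proof. by apply/funext => p; rewrite /qadd addrA. Qed.
Lemma qaddC f g : qadd f g = qadd g f.
Proof. by apply/funext => p; rewrite /qadd addrC. Qed.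
Lemma qadd0 f : qadd (qzero k) f = f.
Proof. by apply/funext => p; rewrite /qadd add0r. Qed.
Lemma qaddN f : qadd (qopp f) f = qzero k.
Proof. by apply/funext => p; rewrite /qadd /qopp addNr. Qed.

Lemma qmulDl f g h : qmul n (qadd f g) h = qadd (qmul n f h) (qmul n g h).
Proof.
by apply/funext => p; rewrite /qadd /qmul -big_split; apply: eq_bigr => j _; rewrite mulrDl.
Qed.

Lemma qmulDr f g h : qmul n h (qadd f g) = qadd (qmul n h f) (qmul n h g).
Proof.
by apply/funext => p; rewrite /qadd /qmul -big_split; apply: eq_bigr => j _; rewrite mulrDr.
Qed.

Lemma qscaleAl c f g : qscale c (qmul n f g) = qmul n (qscale c f) g.
Proof.
by apply/funext => p; rewrite /qscale /qmul mulr_sumr; apply: eq_bigr => j _; rewrite mulrA.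
Qed.

Lemma qscaleAr c f g : qscale c (qmul n f g) = qmul n f (qscale c g).
Proof.
by apply/funext => p; rewrite /qscale /qmul mulr_sumr; apply: eq_bigr => j _; rewrite mulrCA.
Qed.

Lemma qmul0r f : qmul n (qzero k) f = qzero k.
Proof. by apply/funext => p; rewrite /qmul big1 // => j _; rewrite mul0r. Qed.

Lemma qmulr0 f : qmul n f (qzero k) = qzero k.
Proof. by apply/funext => p; rewrite /qmul big1 // => j _; rewrite mulr0. Qed.

(** Induction on the path. With the first letter split off, the derivative of [qmul n f g] is a
    constant times the derivative of [g] plus the derivative of [f] times [g]. *)
Lemma qmulA f g h : qmul n f (qmul n g h) = qmul n (qmul n f g) h.
Proof.
apply/funext => -[v w]; elim: w v f g => [|b w IH] v f g.
  by rewrite !qmul_nil mulrA.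
rewrite !qmul_cons qmul_nil IH mulrDr mulrA -addrA; congr (_ + _).
rewrite -[qmul n (qres v b (qmul n f g)) h _]/(qmul n _ h (_, _)).
have -> : qmul n (qres v b (qmul n f g)) h (qstep v b, w) =
  qmul n (qadd (qscale (f (v, [::])) (qres v b g)) (qmul n (qres v b f) g)) h (qstep v b, w).
  by apply: qmul_congl => w'; rewrite /qres /= qmul_cons.
by rewrite qmulDl -qscaleAl.
Qed.

Lemma qmul_qe_l i f : qmul n (qe k i) f = fun p => (p.1 == i)%:R * f p.
Proof.
apply/funext => -[v [|b w]]; rewrite ?qmul_nil ?qmul_cons /qe /qbasis xpair_eqE andbT //=.
rewrite (_ : qmul n _ _ _ = 0) ?addr0 // /qmul big1 // => j _.
by rewrite /qres /= xpair_eqE andbF mul0r.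
Qed.

Lemma qmul_qe_r i f : qmul n f (qe k i) = fun p => (tgt n p == i)%:R * f p.
Proof.
apply/funext => -[v w]; elim: w v f => [|b w IH] v f.
  by rewrite qmul_nil /qe /qbasis xpair_eqE andbT /= mulrC.
by rewrite qmul_cons IH /qe /qbasis xpair_eqE andbF mulr0 add0r.
Qed.

Lemma qmul_arrow i b g : qmul n (qbasis k (i, [:: b])) g =
  fun p => if p.2 is c :: w then ((p.1 == i) && (c == b))%:R * g (qstep p.1 c, w) else 0.
Proof.
apply/funext => -[v [|c w]] /=; first by rewrite qmul_nil /qbasis xpair_eqE andbF mul0r.
rewrite qmul_cons /qbasis xpair_eqE andbF mul0r add0r.
rewrite (@qmul_congl _ (qscale ((v == i) && (c == b))%:R (qe k (qstep v c)))).
  by rewrite -qscaleAl qmul_qe_l /qscale eqxx mul1r.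
move=> w'; rewrite /qres /qscale /qe /qbasis /= !xpair_eqE eqseq_cons eqxx /=.
by rewrite andbA -natrM mulnb.
Qed.

Lemma qbasis_cons i b w :
  qbasis k (i, b :: w) = qmul n (qbasis k (i, [:: b])) (qbasis k (qstep i b, w)).
Proof.
rewrite qmul_arrow; apply/funext => -[v [|c s]]; rewrite /qbasis xpair_eqE /= ?andbF //.
rewrite eqseq_cons xpair_eqE -natrM mulnb.
by case: (v =P i) => [->|] //=; case: (c =P b) => [->|] //=; rewrite eqxx.
Qed.

Lemma qbasis_mul i w j w' : qmul n (qbasis k (i, w)) (qbasis k (j, w')) =
  qscale (tgt n (i, w) == j)%:R (qbasis k (i, w ++ w')).
Proof.
elim: w i => [|b w IH] i.
  rewrite -/(qe k i) qmul_qe_l; apply/funext => -[v s]; rewrite /qscale /qbasis !xpair_eqE /=.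
  by rewrite /tgt /=; case: (v =P i) => [->|]; rewrite ?mul1r ?mul0r ?mulr0 // -natrM mulnb.
by rewrite cat_cons qbasis_cons -qmulA IH -qscaleAr -qbasis_cons.
Qed.

Lemma fin_supp0 : fin_supp n (qzero k).
Proof. by exists 0%N. Qed.

Lemma fin_suppD f g : fin_supp n f -> fin_supp n g -> fin_supp n (qadd f g).
Proof.
move=> [N Nf] [N' Ng]; exists (maxn N N') => p; rewrite gtn_max /qadd.
case/orP => [lt_p|/andP[l1 l2]]; first by rewrite Nf ?Ng ?lt_p ?addr0.
by rewrite Nf ?Ng ?l1 ?l2 ?orbT ?addr0.
Qed.

Lemma fin_suppZ c f : fin_supp n f -> fin_supp n (qscale c f).
Proof. by move=> [N Nf]; exists N => p /Nf fp0; rewrite /qscale fp0 mulr0. Qed.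

Lemma qoppE f : qopp f = qscale (-1) f.
Proof. by apply/funext => p; rewrite /qscale mulN1r. Qed.

Lemma fin_suppN f : fin_supp n f -> fin_supp n (qopp f).
Proof. by rewrite qoppE; apply: fin_suppZ. Qed.

Lemma fin_suppM f g : fin_supp n f -> fin_supp n g -> fin_supp n (qmul n f g).
Proof.
move=> [N Nf] [N' Ng]; exists (N + N')%N => -[v w] /= lt_p; apply: big1 => /= j _.
case/orP: lt_p => [lt_v|lt_w]; first by rewrite Nf ?mul0r //= lt_v.
have le_j : (j <= size w)%N by rewrite -ltnS ltn_ord.
have [lt_N|le_N] := ltnP N j; first by rewrite Nf ?mul0r //= size_takel // lt_N orbT.
rewrite Ng ?mulr0 //= size_drop ltn_subRL orbC (leq_ltn_trans _ lt_w) //.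
by rewrite leq_add2r.
Qed.

Lemma fin_supp_qbasis i w : (i < n)%N -> fin_supp n (qbasis k (i, w)).
Proof.
move=> lt_i; exists (size w) => p; rewrite /qbasis; case: eqP => // -> /=.
by rewrite leqNgt lt_i ltnn.
Qed.

Lemma fin_supp_ind (P : qfun k -> Prop) :
    P (qzero k) ->
    (forall f g, fin_supp n f -> fin_supp n g -> P f -> P g -> P (qadd f g)) ->
    (forall c i w, (i < n)%N -> P (qscale c (qbasis k (i, w)))) ->
  forall f, fin_supp n f -> P f.
Proof.
(* [Q] carries finite support along with [P], because the hypothesis on sums asks for it in both
   summands. *)
move=> P0' PD' PB' f [N Nf]; pose Q g := fin_supp n g /\ P g.
have P0 : Q (qzero k) by split=> //; apply: fin_supp0.
have PD g h : Q g -> Q h -> Q (qadd g h).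
  by move=> [? ?] [? ?]; split; [apply: fin_suppD | apply: PD'].
have PB c i w : (i < n)%N -> Q (qscale c (qbasis k (i, w))).
  by move=> lt_i; split; [apply/fin_suppZ/fin_supp_qbasis | apply: PB'].
suff [] : Q f by [].
have Psum (I : Type) (r : seq I) (F : I -> qfun k) :
    (forall i, Q (F i)) -> Q (fun p => \sum_(i <- r) F i p).
  move=> PF; elim: r => [|a r IH].
    by rewrite (_ : (fun _ => _) = qzero k) //; apply/funext => p; rewrite big_nil.
  rewrite (_ : (fun _ => _) = qadd (F a) (fun p => \sum_(i <- r) F i p)); first exact: PD.
  by apply/funext => p; rewrite big_cons.
(* [f] is the sum of its values on paths, sorted by start vertex, length and word; the bound [N]
   makes this sum finite. *)
suff -> : f = fun p => \sum_(i < n) (fun p => \sum_(l < N.+1)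
   (fun p => \sum_(w : l.-tuple bool) qscale (f (nat_of_ord i, val w)) (qbasis k (nat_of_ord i, val w)) p) p) p.
  by do 3 (apply: (@Psum) => ?); apply: PB.
apply/funext => -[v w]; have [/= lt_vw|] := boolP ((n <= v)%N || (N < size w)%N).
  rewrite Nf //; symmetry; apply: big1 => i _; apply: big1 => l _; apply: big1 => t _.
  rewrite /qscale /qbasis xpair_eqE; case: (v =P i) => /= [vi|]; last by rewrite mulr0.
  case: (w =P t) => [wt|]; rewrite ?mulr0 // mulr1; move: lt_vw.
  by rewrite vi wt leqNgt ltn_ord size_tuple ltnNge -ltnS ltn_ord.
rewrite negb_or -ltnNge -leqNgt => /andP[lt_v le_w].
rewrite (bigD1 (Ordinal lt_v)) //= (bigD1 (Ordinal (le_w : (size w < N.+1)%N))) //=.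
rewrite (bigD1 (in_tuple w)) //= /qscale {1}/qbasis eqxx mulr1 -!addrA.
rewrite !big1 ?addr0 // => [i ne_i|l ne_l|t ne_t]; first last.
- rewrite /qbasis xpair_eqE eqxx /=; case: (w =P t) => [wt|]; rewrite ?mulr0 //.
  by case/eqP: ne_t; apply: val_inj.
- apply: big1 => t _; rewrite /qbasis xpair_eqE eqxx /=; case: (w =P t) => [wt|]; rewrite ?mulr0 //.
  by case/eqP: ne_l; apply: val_inj; rewrite /= wt size_tuple.
apply: big1 => l _; apply: big1 => t _; rewrite /qbasis xpair_eqE.
by case: (v =P i) => [vi|]; rewrite ?mulr0 //; case/eqP: ne_i; apply: val_inj.
Qed.

End PathFunctions.

(** * Weight representations *)

Section Vertices.
Variable n0 : nat.
Local Notation n := n0.+1.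

(** The integers unroll the cyclic quiver to an infinite line, on which the weights of a
    representation need not be periodic. *)
Definition vtx (a : int) : nat := `|(a %% n%:Z)%Z|%N.

Lemma vtx_modz a : (vtx a)%:Z = (a %% n%:Z)%Z.
Proof. by rewrite /vtx gez0_abs // modz_ge0. Qed.

Lemma vtx_lt a : (vtx a < n)%N.
Proof. by rewrite -ltz_nat vtx_modz ltz_pmod. Qed.

Definition vord (a : int) : 'I_n := Ordinal (vtx_lt a).

Lemma vtx_nat i : (i < n)%N -> vtx i = i.
Proof. by move=> lt_i; rewrite /vtx modz_nat absz_nat modn_small. Qed.

Lemma vord_nat (i : 'I_n) : vord (nat_of_ord i) = i.
Proof. by apply: val_inj; rewrite /= vtx_nat. Qed.

Lemma eq_vtx a b : (vtx a == vtx b) = (a == b %[mod n%:Z])%Z.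
Proof. by rewrite -eqz_nat !vtx_modz. Qed.

Lemma vup_vtx a : vup n (vtx a) = vtx (a + 1).
Proof.
apply/eqP; rewrite -eqz_nat /vup vtx_modz -modz_nat -addn1 PoszD vtx_modz.
by rewrite modzDml.
Qed.

Lemma vdown_vtx a : vdown n (vtx a) = vtx (a - 1).
Proof.
apply/eqP; rewrite -eqz_nat /vdown vtx_modz -modz_nat PoszD vtx_modz modzDml.
by rewrite -(modzDr (a - 1)) /= -addn1 PoszD addrACA addNr addr0.
Qed.

Lemma eq_vtxD a b c : (vtx (a + c) == vtx (b + c)) = (vtx a == vtx b).
Proof. by rewrite !eq_vtx eqz_modDr. Qed.

Lemma qstep_vtx a b : qstep n0 (vtx a) b = vtx (if b then a + 1 else a - 1).
Proof. by rewrite /qstep; case: b; rewrite ?vup_vtx ?vdown_vtx. Qed.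

End Vertices.

Section Representation.
Variables (k : fieldType) (n0 : nat).
Local Notation n := n0.+1.
Variables (K : comNzRingType) (phi : {rmorphism k -> K}) (mu nu : int -> K).
Implicit Types (f g h : qfun k) (w : seq bool) (psi : int -> K) (a : int).

Fixpoint wpos a w := if w is b :: w' then wpos (if b then a + 1 else a - 1) w' else a.

(** Both arrows between [a] and [a + 1] are indexed by [a]: the upward one has weight [mu a], the
    downward one [nu a]. A step down from [a] therefore contributes [nu (a - 1)]. *)
Fixpoint wcoef a w : K := if w is b :: w'
  then (if b then mu a else nu (a - 1)) * wcoef (if b then a + 1 else a - 1) w' else 1.

Lemma wpos_cat a w w' : wpos a (w ++ w') = wpos (wpos a w) w'.
Proof. by elim: w a => //= b w IH a. Qed.

Lemma wcoef_cat a w w' : wcoef a (w ++ w') = wcoef a w * wcoef (wpos a w) w'.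
Proof. by elim: w a => [|b w IH] a /=; rewrite ?mul1r // IH mulrA. Qed.

Lemma vtx_wpos a w : vtx n0 (wpos a w) = tgt n (vtx n0 a, w).
Proof. by elim: w a => //= b w IH a; rewrite IH -qstep_vtx. Qed.

Definition len_bound (N : nat) f := forall p, (N <= size p.2)%N -> f p = 0.

Definition actN N f psi a : K :=
  \sum_(l < N) \sum_(w : l.-tuple bool) phi (f (vtx n0 a, val w)) * (wcoef a w * psi (wpos a w)).

(* Operators on column vectors [int -> K] rather than row vectors of finite
   support: composing them needs no summation over the index set. *)
Definition act f : (int -> K) -> int -> K :=
  actN (if pselect (exists N, len_bound N f) is left h then projT1 (cid h) else 0%N) f.

(** Words beyond the bound contribute nothing, so the bound that [act] picks by choice is
    immaterial. *)
Lemma actN_widen N d f psi a : len_bound N f -> actN (N + d) f psi a = actN N f psi a.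
Proof.
move=> Nf; elim: d => [|d IH]; first by rewrite addn0.
rewrite addnS /actN big_ord_recr /= -[X in X + _]/(actN (N + d) f psi a) IH.
rewrite [X in _ + X]big1 ?addr0 // => w _.
by rewrite Nf ?rmorph0 ?mul0r //= size_tuple leq_addr.
Qed.

Lemma actE N f psi a : len_bound N f -> act f psi a = actN N f psi a.
Proof.
move=> Nf; rewrite /act; case: pselect => [h|[]]; last by exists N.
case: (cid h) => M /= Mf; case/orP: (leq_total M N) => /subnKC E.
  by rewrite -(actN_widen (N - M) psi a Mf) E.
by rewrite -(actN_widen (M - N) psi a Nf) E.
Qed.

Lemma fin_supp_bound f : fin_supp n f -> exists N, len_bound N f.
Proof. by move=> [N Nf]; exists N.+1 => p lt_p; rewrite Nf // lt_p orbT. Qed.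

Lemma act_ext f psi psi' a : (forall b, psi b = psi' b) -> act f psi a = act f psi' a.
Proof. by move=> E; congr act; apply/funext. Qed.

Lemma act0 psi a : act (qzero k) psi a = 0.
Proof. by rewrite (@actE 0) // /actN big_ord0. Qed.

Lemma actD f g psi a : fin_supp n f -> fin_supp n g ->
  act (qadd f g) psi a = act f psi a + act g psi a.
Proof.
move=> /fin_supp_bound[N Nf] /fin_supp_bound[M Mg].
have Bf : len_bound (N + M) f by move=> p /(leq_trans (leq_addr _ _)); apply: Nf.
have Bg : len_bound (N + M) g by move=> p /(leq_trans (leq_addl _ _)); apply: Mg.
have Bfg : len_bound (N + M) (qadd f g) by move=> p le_p; rewrite /qadd Bf ?Bg ?addr0.
rewrite !(@actE (N + M)) // /actN -big_split; apply: eq_bigr => l _.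
by rewrite -big_split; apply: eq_bigr => w _; rewrite /qadd rmorphD mulrDl.
Qed.

Lemma actZ c f psi a : fin_supp n f -> act (qscale c f) psi a = phi c * act f psi a.
Proof.
move=> /fin_supp_bound[N Nf].
have Bf : len_bound N (qscale c f) by move=> p le_p; rewrite /qscale Nf ?mulr0.
rewrite !(@actE N) // /actN mulr_sumr; apply: eq_bigr => l _.
by rewrite mulr_sumr; apply: eq_bigr => w _; rewrite /qscale rmorphM -mulrA.
Qed.

Lemma act_qbasis i w psi a :
  act (qbasis k (i, w)) psi a = (vtx n0 a == i)%:R * (wcoef a w * psi (wpos a w)).
Proof.
rewrite (@actE (size w).+1); last first.
  by move=> p lt_p; rewrite /qbasis; case: eqP => // pE; rewrite pE ltnn in lt_p.
rewrite /actN big_ord_recr /= big1 ?add0r => [|l _].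
  rewrite (bigD1 (in_tuple w)) //= /qbasis xpair_eqE eqxx andbT rmorph_nat.
  rewrite big1 ?addr0 // => t ne_t; rewrite xpair_eqE [_ == w](_ : _ = false) ?andbF ?rmorph0 ?mul0r //.
  by apply/negbTE; apply: contraNneq ne_t => tE; apply/eqP/val_inj.
apply: big1 => t _; rewrite /qbasis xpair_eqE [_ == w](_ : _ = false) ?andbF ?rmorph0 ?mul0r //.
by apply/eqP => tE; have := ltn_ord l; rewrite -[X in (_ < X)%N -> _](congr1 size tE) size_tuple ltnn.
Qed.

(** By bilinearity it is enough to treat two paths, where the claim is that weights multiply along a
    concatenation. *)
Lemma act_mul f g psi a : fin_supp n f -> fin_supp n g ->
  act (qmul n f g) psi a = act f (act g psi) a.
Proof.
move=> Ff Fg; move: f Ff a; apply: fin_supp_ind => [a|f h Ff Fh Ef Eh a|c i w lt_i a].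
- by rewrite qmul0r !act0.
- by rewrite qmulDl !actD ?Ef ?Eh //; apply: fin_suppM.
have Fi u : fin_supp n (qbasis k (i, u)) by apply: fin_supp_qbasis.
rewrite -qscaleAl !actZ //; last exact: fin_suppM.
congr (_ * _); move: g Fg; apply: fin_supp_ind => [|f g Ff Fg Ef Eg|c' j w' lt_j].
- by rewrite qmulr0 act0 act_qbasis act0 !mulr0.
- rewrite qmulDr actD ?Ef ?Eg ?act_qbasis ?actD //; try exact: fin_suppM.
  by rewrite !mulrDr.
rewrite -qscaleAr qbasis_mul !actZ ?act_qbasis ?actZ ?act_qbasis //;
  try by [apply: fin_supp_qbasis | apply/fin_suppZ/fin_supp_qbasis].
rewrite wcoef_cat wpos_cat vtx_wpos.
case: (_ =P i) => [->|_]; rewrite ?mul0r ?mulr0 // rmorph_nat; ring.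
Qed.

Lemma act_qe b psi a : act (qe k (vtx n0 b)) psi a = (vtx n0 a == vtx n0 b)%:R * psi a.
Proof. by rewrite act_qbasis /= mul1r. Qed.

Lemma act_qu b psi a :
  act (qu k (vtx n0 b)) psi a = (vtx n0 a == vtx n0 b)%:R * (mu a * psi (a + 1)).
Proof. by rewrite act_qbasis /= mulr1. Qed.

Lemma act_qd b psi a : act (qd k n (vtx n0 b)) psi a =
  (vtx n0 a == vtx n0 (b + 1))%:R * (nu (a - 1) * psi (a - 1)).
Proof. by rewrite act_qbasis /= vup_vtx mulr1. Qed.

Lemma fin_supp_qe b : fin_supp n (qe k (vtx n0 b)).
Proof. exact/fin_supp_qbasis/vtx_lt. Qed.
Lemma fin_supp_qu b : fin_supp n (qu k (vtx n0 b)).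
Proof. exact/fin_supp_qbasis/vtx_lt. Qed.
Lemma fin_supp_qd b : fin_supp n (qd k n (vtx n0 b)).
Proof. by apply: fin_supp_qbasis; rewrite vup_vtx vtx_lt. Qed.
#[local] Hint Resolve fin_supp_qe fin_supp_qu fin_supp_qd : core.
#[local] Hint Resolve fin_suppM fin_suppD fin_suppN fin_suppZ fin_supp_qbasis : core.

Variables alpha beta gamma : 'I_n -> k.

(** At [a] the loops [u d] and [d u] act by [mu a * nu a] and [mu (a - 1) * nu (a - 1)]; this is the
    scalar by which both relations at the vertex of [a] fail. *)
Definition weight_defect (a : int) : K :=
  let i := vord n0 a in
  mu (a - 1) * nu (a - 1) - phi (alpha i) * (mu a * nu a)
    - phi (beta i) * (mu (a + 1) * nu (a + 1)) - phi (gamma i).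

Lemma fin_supp_rel1 i : fin_supp n (rel1 alpha beta gamma i).
Proof.
rewrite /rel1 -(vtx_nat (ltn_ord i)) vdown_vtx vup_vtx.
by do !(apply: fin_suppD || apply: fin_suppN || apply: fin_suppZ || apply: fin_suppM).
Qed.

Lemma fin_supp_rel2 i : fin_supp n (rel2 alpha beta gamma i).
Proof.
rewrite /rel2 -(vtx_nat (ltn_ord i)) vdown_vtx vup_vtx.
by do !(apply: fin_suppD || apply: fin_suppN || apply: fin_suppZ || apply: fin_suppM).
Qed.

Lemma actN1 f psi a : fin_supp n f -> act (qopp f) psi a = - act f psi a.
Proof. by move=> Ff; rewrite qoppE actZ // rmorphN1 mulN1r. Qed.

Let actS := (act_qe, act_qu, act_qd, actD, actN1, actZ, act_mul).

Lemma act_rel1 i psi a :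
  act (rel1 alpha beta gamma i) psi a =
  (vtx n0 a == i)%:R * (mu a * weight_defect a * psi (a + 1)).
Proof.
rewrite /weight_defect /rel1 -(vtx_nat (ltn_ord i)) vdown_vtx vup_vtx; set b : int := i.
rewrite ?actS;
  try by do ?[apply: fin_suppD | apply: fin_suppN | apply: fin_suppZ | apply: fin_suppM].
rewrite !subrK !addrK.
have [E|_] := eqVneq (vtx n0 a) (vtx n0 b); last by rewrite !mul0r !mulr0 !addr0 subr0.
have -> : vord n0 a = i by apply: val_inj; rewrite /= E vtx_nat.
rewrite ?eq_vtxD ?E ?eqxx !mul1r; ring.
Qed.

Lemma act_rel2 i psi a :
  act (rel2 alpha beta gamma i) psi a =
  (vtx n0 (a - 1) == i)%:R * (nu (a - 1) * weight_defect (a - 1) * psi (a - 1)).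
Proof.
rewrite /weight_defect /rel2 -(vtx_nat (ltn_ord i)) vdown_vtx vup_vtx; set b : int := i.
rewrite ?actS;
  try by do ?[apply: fin_suppD | apply: fin_suppN | apply: fin_suppZ | apply: fin_suppM].
rewrite !subrK !addrK.
have -> : (vtx n0 a == vtx n0 (b + 1)) = (vtx n0 (a - 1) == vtx n0 b).
  by rewrite -(eq_vtxD _ (a - 1) b 1) subrK.
have [E|_] := eqVneq (vtx n0 (a - 1)) (vtx n0 b); last by rewrite !mul0r !mulr0 !addr0 subr0.
have -> : vord n0 (a - 1) = i by apply: val_inj; rewrite /= E vtx_nat.
have Ea : vtx n0 a = vtx n0 (b + 1) by apply/eqP; rewrite -(eq_vtxD _ _ _ (-1)) addrK E.
rewrite ?eq_vtxD ?E ?Ea ?eqxx !mul1r; ring.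
Qed.

Hypothesis mu_defect : forall a, mu a * weight_defect a = 0.
Hypothesis nu_defect : forall a, nu a * weight_defect a = 0.

(** The relations act through the products of the defect with [mu] and [nu]. The defect itself may
    survive at an index where both weights vanish, which the truncated action exploits. *)
Lemma act_inI f psi a : inI alpha beta gamma f -> fin_supp n f /\ act f psi a = 0.
Proof.
move=> If; elim: If psi a => {f} [|f g i Ff Fg|f g i Ff Fg|f g _ IHf _ IHg|f g _ IHf /funext <-] // psi a.
- by rewrite act0; split=> //; apply: fin_supp0.
- have Fr := fin_supp_rel1 i; have Frg := fin_suppM Fr Fg.
  split; first exact: fin_suppM.
  rewrite act_mul // (@act_ext _ _ (fun=> 0)); last first.
    by move=> b; rewrite act_mul // act_rel1 mu_defect mul0r mulr0.
  by rewrite /act /actN big1 // => l _; rewrite big1 // => w _; rewrite !mulr0.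
- have Fr := fin_supp_rel2 i; have Frg := fin_suppM Fr Fg.
  split; first exact: fin_suppM.
  rewrite act_mul // (@act_ext _ _ (fun=> 0)); last first.
    by move=> b; rewrite act_mul // act_rel2 nu_defect mul0r mulr0.
  by rewrite /act /actN big1 // => l _; rewrite big1 // => w _; rewrite !mulr0.
have [[Ff Ef] [Fg Eg]] := (IHf psi a, IHg psi a).
by split; [apply: fin_suppD | rewrite actD // Ef Eg addr0].
Qed.

End Representation.

(** * The quotient algebra *)

Record path_alg (k : fieldType) (n0 : nat) :=
  PathAlg {pa_val : qfun k; pa_fin : fin_supp n0.+1 pa_val}.

HB.instance Definition _ k n0 := gen_eqMixin (path_alg k n0).
HB.instance Definition _ k n0 := gen_choiceMixin (path_alg k n0).

Section QuotientAlgebra.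
Variables (k : fieldType) (n0 : nat).
Local Notation n := n0.+1.
Variables alpha beta gamma : 'I_n -> k.
Implicit Types f g h : qfun k.

#[local] Hint Resolve pa_fin fin_supp0 : core.

Local Notation inI := (inI alpha beta gamma).

Lemma inI_scale c f : inI f -> inI (qscale c f).
Proof.
elim=> [|a b i Fa Fb|a b i Fa Fb|g h _ Ig _ Ih|g h _ Ig /funext <-] //.
- by apply: inI_ext (inI0 _ _ _) _ => p; rewrite /qscale mulr0.
- by rewrite qscaleAl; apply: inI_gen1 => //; apply: fin_suppZ.
- by rewrite qscaleAl; apply: inI_gen2 => //; apply: fin_suppZ.
- by apply: inI_ext (inI_add Ig Ih) _ => p; rewrite /qscale /qadd mulrDr.
Qed.

Lemma inI_opp f : inI f -> inI (qopp f).
Proof. by rewrite qoppE; apply: inI_scale. Qed.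

Lemma inI_mull a f : fin_supp n a -> inI f -> inI (qmul n a f).
Proof.
move=> Fa; elim=> [|b c i Fb Fc|b c i Fb Fc|g h _ Ig _ Ih|g h _ Ig /funext <-] //.
- by rewrite qmulr0; apply: inI0.
- by rewrite qmulA; apply: inI_gen1 => //; apply: fin_suppM.
- by rewrite qmulA; apply: inI_gen2 => //; apply: fin_suppM.
- by rewrite qmulDr; apply: inI_add.
Qed.

Lemma inI_mulr a f : fin_supp n a -> inI f -> inI (qmul n f a).
Proof.
move=> Fa; elim=> [|b c i Fb Fc|b c i Fb Fc|g h _ Ig _ Ih|g h _ Ig /funext <-] //.
- by rewrite qmul0r; apply: inI0.
- by rewrite -!qmulA; apply: inI_gen1 => //; apply: fin_suppM.
- by rewrite -!qmulA; apply: inI_gen2 => //; apply: fin_suppM.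
- by rewrite qmulDl; apply: inI_add.
Qed.

Definition eqI : rel (path_alg k n0) :=
  fun x y => `[< inI (qadd (pa_val x) (qopp (pa_val y))) >].

Lemma eqI_refl : reflexive eqI.
Proof. by move=> x; apply/asboolP; rewrite qaddC qaddN; apply: inI0. Qed.

Lemma eqI_sym : symmetric eqI.
Proof.
have S x y : eqI x y -> eqI y x.
  move=> /asboolP/inI_opp I; apply/asboolP; apply: inI_ext I _ => p.
  by rewrite /qopp /qadd opprD opprK addrC.
by move=> x y; apply/idP/idP; apply: S.
Qed.

Lemma eqI_trans : transitive eqI.
Proof.
move=> y x z /asboolP Ixy /asboolP Iyz; apply/asboolP.
by apply: inI_ext (inI_add Ixy Iyz) _ => p; rewrite /qadd /qopp addrA subrK.
Qed.

Canonical eqI_equiv := EquivRel eqI eqI_refl eqI_sym eqI_trans.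

Local Open Scope quotient_scope.

Definition halg := {eq_quot eqI}.
HB.instance Definition _ := Choice.on halg.
HB.instance Definition _ := EqQuotient.on halg.

(** Made total by sending functions without finite support to the class of zero, so that it applies
    directly to raw functions. *)
Definition cls f : halg := locked (\pi_halg
  (if pselect (fin_supp n f) is left Ff then PathAlg Ff else PathAlg (fin_supp0 k n0))).

Definition hrep (x : halg) : qfun k := pa_val (repr x).

Lemma fin_hrep x : fin_supp n (hrep x). Proof. exact: pa_fin. Qed.

Lemma cls_val (x : path_alg k n0) : cls (pa_val x) = \pi x.
Proof.
rewrite /cls -lock; case: pselect => [F|[]]; last exact: pa_fin.
by case: x F => f Ff F; do 2 congr (_ _); apply: Prop_irrelevance.
Qed.

Lemma hrepK x : cls (hrep x) = x.
Proof. by rewrite cls_val reprK. Qed.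

Lemma clsP f g : fin_supp n f -> fin_supp n g ->
  cls f = cls g <-> inI (qadd f (qopp g)).
Proof.
move=> Ff Fg; rewrite -[f]/(pa_val (PathAlg Ff)) -[g]/(pa_val (PathAlg Fg)) !cls_val.
by split=> [/eqmodP/asboolP | I]; last by apply/eqmodP/asboolP.
Qed.

Lemma cls_hrep f : fin_supp n f -> inI (qadd (hrep (cls f)) (qopp f)).
Proof. by move=> Ff; apply/clsP; rewrite ?hrepK //; apply: fin_hrep. Qed.

Definition hadd (x y : halg) : halg := cls (qadd (hrep x) (hrep y)).
Definition hopp (x : halg) : halg := cls (qopp (hrep x)).
Definition hmul (x y : halg) : halg := cls (qmul n (hrep x) (hrep y)).
Definition hscale c (x : halg) : halg := cls (qscale c (hrep x)).

#[local] Hint Resolve fin_hrep fin_suppD fin_suppN fin_suppM fin_suppZ : core.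

Lemma haddE f g : fin_supp n f -> fin_supp n g -> hadd (cls f) (cls g) = cls (qadd f g).
Proof.
move=> Ff Fg; apply/clsP; [by auto | by auto|].
apply: inI_ext (inI_add (cls_hrep Ff) (cls_hrep Fg)) _ => p.
by rewrite /qadd /qopp opprD addrACA.
Qed.

Lemma hscaleE c f : fin_supp n f -> hscale c (cls f) = cls (qscale c f).
Proof.
move=> Ff; apply/clsP; [by auto | by auto|].
by apply: inI_ext (inI_scale c (cls_hrep Ff)) _ => p; rewrite /qscale /qadd /qopp mulrBr.
Qed.

Lemma hoppE f : fin_supp n f -> hopp (cls f) = cls (qopp f).
Proof. by move=> Ff; rewrite qoppE -hscaleE // /hopp qoppE. Qed.

Lemma hmulE f g : fin_supp n f -> fin_supp n g -> hmul (cls f) (cls g) = cls (qmul n f g).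
Proof.
move=> Ff Fg; apply/clsP; [by auto | by auto|].
have I1 := inI_mulr (fin_hrep (cls g)) (cls_hrep Ff).
have I2 := inI_mull Ff (cls_hrep Fg).
rewrite qmulDl in I1; rewrite qmulDr in I2.
apply: inI_ext (inI_add I1 I2) _ => p; rewrite !qoppE -qscaleAl -qscaleAr -!qoppE.
by rewrite /qadd /qopp addrA subrK.
Qed.

Definition qone : qfun k := fun p => ((p.1 < n)%N && (p.2 == [::]))%:R.

Lemma fin_qone : fin_supp n qone.
Proof.
by exists 0%N => -[v [|b w]] /=; rewrite /qone /= ?andbF // orbF andbT leqNgt => /negbTE ->.
Qed.

Lemma qmul1q f : fin_supp n f -> qmul n qone f = f.
Proof.
move=> [N Nf]; apply/funext => -[v w].
rewrite (@qmul_congl _ _ _ (qscale (v < n)%N%:R (qe k v))).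
  rewrite -qscaleAl qmul_qe_l /qscale eqxx mul1r.
  by case: ltnP => [|le_v]; rewrite ?mul1r // Nf ?mulr0 //= le_v.
by move=> w'; rewrite /qone /qscale /qe /qbasis xpair_eqE eqxx /= -natrM mulnb.
Qed.

Lemma qmulq1 f : fin_supp n f -> qmul n f qone = f.
Proof.
move: f; apply: fin_supp_ind => [|f g _ _ Ef Eg|c i w lt_i].
- by rewrite qmul0r.
- by rewrite qmulDl Ef Eg.
rewrite -qscaleAl; congr qscale; elim: w i lt_i => [|b w IH] i lt_i.
  rewrite -/(qe k i) qmul_qe_l /qone /qe /qbasis; apply/funext => -[v w].
  by rewrite xpair_eqE /=; case: eqP => [->|]; rewrite ?mul0r // lt_i mul1r.
rewrite (@qbasis_cons k n0) -qmulA IH // /qstep.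
by case: b; rewrite /vup /vdown ltn_pmod.
Qed.

Lemma hind (P : halg -> Prop) :
  (forall f, fin_supp n f -> P (cls f)) -> forall x, P x.
Proof. by move=> Pf x; rewrite -(hrepK x); apply: Pf. Qed.

Local Notation hE := (haddE, hmulE, hoppE, hscaleE).

Lemma haddA : associative hadd.
Proof.
by do 3 (apply: hind => ? ?); rewrite ?hE ?qaddA; auto.
Qed.
Lemma haddC : commutative hadd.
Proof. by do 2 (apply: hind => ? ?); rewrite ?hE // qaddC. Qed.
Lemma hadd0 : left_id (cls (qzero k)) hadd.
Proof. by apply: hind => ? ?; rewrite ?hE // qadd0. Qed.
Lemma haddN : left_inverse (cls (qzero k)) hopp hadd.
Proof. by apply: hind => ? ?; rewrite ?hE ?qaddN; auto. Qed.
HB.instance Definition _ := GRing.isZmodule.Build halg haddA haddC hadd0 haddN.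

Lemma hmulA : associative hmul.
Proof. by do 3 (apply: hind => ? ?); rewrite ?hE ?qmulA; auto. Qed.
Lemma hmul1 : left_id (cls qone) hmul.
Proof. by apply: hind => f Ff; rewrite hE ?qmul1q //; apply: fin_qone. Qed.
Lemma hmulr1 : right_id (cls qone) hmul.
Proof. by apply: hind => f Ff; rewrite hE ?qmulq1 //; apply: fin_qone. Qed.
Lemma hmulDl : left_distributive hmul +%R.
Proof.
do 3 (apply: hind => ? ?); rewrite -[+%R]/hadd ?hE ?qmulDl; auto.
Qed.
Lemma hmulDr : right_distributive hmul +%R.
Proof. do 3 (apply: hind => ? ?); rewrite -[+%R]/hadd ?hE ?qmulDr; auto. Qed.

(* The representation with all arrows acting by 0. *)
Lemma hone_neq0 : cls qone != 0.
Proof.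
apply/eqP => /(clsP fin_qone (fin_supp0 k n0)) I.
(* Multiplying by the idempotent at 0 replaces [qone] by a single trivial path, whose action is
   known. *)
have {}I : inI (qmul n (qe k 0%N) qone).
  apply: inI_mull; first exact: fin_supp_qbasis.
  by apply: inI_ext I _ => p; rewrite /qadd /qopp subr0.
have D0 a : (fun=> 0 : k) a * weight_defect idfun (fun=> 0) (fun=> 0) alpha beta gamma a = 0.
  by rewrite mul0r.
rewrite qmulq1 in I; last exact: fin_supp_qbasis.
have [_] := act_inI D0 D0 (fun=> 1) 0 I.
by rewrite act_qbasis (vtx_nat (isT : (0 < n)%N)) eqxx /= !mul1r => /eqP; rewrite oner_eq0.
Qed.
HB.instance Definition _ := GRing.Zmodule_isNzRing.Build halg
  hmulA hmul1 hmulr1 hmulDl hmulDr hone_neq0.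

Lemma hscaleA a b x : hscale a (hscale b x) = hscale (a * b) x.
Proof.
move: x; apply: hind => f Ff; rewrite !hE; auto.
by congr cls; apply/funext => p; rewrite /qscale mulrA.
Qed.
Lemma hscale1 : left_id 1 hscale.
Proof.
by apply: hind => f Ff; rewrite hE //; congr cls; apply/funext => p; rewrite /qscale mul1r.
Qed.
Lemma hscaleDr : right_distributive hscale +%R.
Proof.
move=> c; do 2 (apply: hind => ? ?); rewrite -[+%R]/hadd ?hE; auto.
by congr cls; apply/funext => p; rewrite /qscale mulrDr.
Qed.
Lemma hscaleDl x : {morph hscale^~ x : a b / a + b}.
Proof.
move=> a b; move: x; apply: hind => f Ff; rewrite -[X in _ = X]/(hadd _ _) ?hE; auto.
by congr cls; apply/funext => p; rewrite /qscale mulrDl.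
Qed.
HB.instance Definition _ := GRing.Zmodule_isLmodule.Build k halg
  hscaleA hscale1 hscaleDr hscaleDl.

Lemma hscaleAl c x y : c *: (x * y : halg) = (c *: x) * y.
Proof.
rewrite -[*:%R]/hscale -[*%R]/hmul; move: x y.
by do 2 (apply: hind => ? ?); rewrite ?hE ?qscaleAl; auto.
Qed.
HB.instance Definition _ := GRing.Lmodule_isLalgebra.Build k halg hscaleAl.

Lemma hscaleAr c x y : c *: (x * y : halg) = x * (c *: y).
Proof.
rewrite -[*:%R]/hscale -[*%R]/hmul; move: x y.
by do 2 (apply: hind => ? ?); rewrite ?hE ?qscaleAr; auto.
Qed.
HB.instance Definition _ := GRing.Lalgebra_isAlgebra.Build k halg hscaleAr.

Lemma clsD f g : fin_supp n f -> fin_supp n g -> cls (qadd f g) = cls f + cls g.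
Proof. by move=> Ff Fg; rewrite -haddE. Qed.
Lemma clsM f g : fin_supp n f -> fin_supp n g -> cls (qmul n f g) = cls f * cls g.
Proof. by move=> Ff Fg; rewrite -hmulE. Qed.
Lemma clsN f : fin_supp n f -> cls (qopp f) = - cls f.
Proof. by move=> Ff; rewrite -hoppE. Qed.
Lemma clsZ c f : fin_supp n f -> cls (qscale c f) = c *: cls f.
Proof. by move=> Ff; rewrite -hscaleE. Qed.
Lemma cls0 : cls (qzero k) = 0. Proof. by []. Qed.
Lemma cls_eq0 f : fin_supp n f -> cls f = 0 <-> inI f.
Proof.
move=> Ff; rewrite -cls0 clsP //; split=> I; apply: inI_ext I _ => p;
by rewrite /qadd /qopp subr0.
Qed.

End QuotientAlgebra.

(* The arrows are gathered into U = sum of the u_i and D = sum of the d_i, and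
   vertices are indexed by integers read mod n; the axioms are stable under
   passing to the opposite algebra and exchanging U and D. *)
Record down_up (k : fieldType) (n0 : nat) (A : algType k) (e : int -> A) (U D : A)
    (al be ga : int -> k) : Prop := DownUp {
  du_eE : forall a b, vtx n0 a = vtx n0 b -> e a = e b;
  du_ee : forall a b, e a * e b = if vtx n0 a == vtx n0 b then e a else 0;
  du_e1 : \sum_(i < n0.+1) e (i : nat) = 1;
  du_eU : forall a, e a * U = U * e (a + 1);
  du_De : forall a, D * e a = e (a + 1) * D;
  du_DUU : forall a, e a * (D * U * U) =
    al a *: (e a * (U * D * U)) + be a *: (e a * (U * U * D)) + ga a *: (e a * U);
  du_DDU : forall a, D * D * U * e a =
    al a *: (D * U * D * e a) + be a *: (U * D * D * e a) + ga a *: (D * e a);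
  du_indl : forall P : A -> Prop, (forall x y, P x -> P y -> P (x + y)) ->
    (forall c x, P x -> P (c *: x)) -> (forall a, P (e a)) ->
    (forall x, P x -> P (U * x)) -> (forall x, P x -> P (D * x)) -> forall x, P x;
  du_indr : forall P : A -> Prop, (forall x y, P x -> P y -> P (x + y)) ->
    (forall c x, P x -> P (c *: x)) -> (forall a, P (e a)) ->
    (forall x, P x -> P (x * U)) -> (forall x, P x -> P (x * D)) -> forall x, P x }.

Definition at_vtx (k : fieldType) (n0 : nat) (c : 'I_n0.+1 -> k) (a : int) : k :=
  c (vord n0 a).

Section QuiverDownUp.
Variables (k : fieldType) (n0 : nat).
Local Notation n := n0.+1.
Variables alpha beta gamma : 'I_n -> k.
Local Notation H := (halg alpha beta gamma).
Local Notation cls := (cls alpha beta gamma).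

Definition arrows (b : bool) : qfun k := fun p => ((p.1 < n)%N && (p.2 == [:: b]))%:R.

Lemma fin_arrows b : fin_supp n (arrows b).
Proof.
exists 1%N => -[v w]; rewrite /arrows /= leqNgt; case: (v < n)%N => //=.
by case: (w =P [:: b]) => [->|].
Qed.

Lemma qe_arrows a b : qmul n (qe k (vtx n0 a)) (arrows b) = qbasis k (vtx n0 a, [:: b]).
Proof.
rewrite qmul_qe_l; apply/funext => -[v w]; rewrite /arrows /qbasis xpair_eqE -natrM mulnb /=.
by case: eqP => //= ->; rewrite vtx_lt.
Qed.

Lemma arrows_qe a b : qmul n (arrows b) (qe k (vtx n0 (if b then a + 1 else a - 1))) =
  qbasis k (vtx n0 a, [:: b]).
Proof.
rewrite qmul_qe_r; apply/funext => -[v w]; rewrite /arrows /qbasis xpair_eqE -natrM mulnb /=.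
case: (w =P [:: b]) => [->|]; rewrite ?andbF ?andbT //=.
have [lt_v|le_v] := ltnP v n; last first.
  by rewrite andbF; case: eqP => // vE; rewrite vE leqNgt vtx_lt in le_v.
have vE := vtx_nat lt_v.
by rewrite andbT -[tgt _ _]/(qstep n0 v b) -{1}vE qstep_vtx -[in RHS]vE; case: b; rewrite eq_vtxD.
Qed.

Definition he (a : int) : H := cls (qe k (vtx n0 a)).
Definition hU : H := cls (arrows true).
Definition hD : H := cls (arrows false).

#[local] Hint Resolve fin_arrows fin_supp_qe fin_suppM fin_suppD fin_suppN fin_suppZ : core.

Lemma cls_qu_l a : cls (qu k (vtx n0 a)) = he a * hU.
Proof. by rewrite /he /hU -clsM // qe_arrows. Qed.
Lemma cls_qu_r a : cls (qu k (vtx n0 a)) = hU * he (a + 1).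
Proof. by rewrite /he /hU -clsM // (arrows_qe a true). Qed.
Lemma cls_qd_l a : cls (qd k n (vtx n0 a)) = he (a + 1) * hD.
Proof. by rewrite /he /hD -clsM // qe_arrows /qd vup_vtx. Qed.
Lemma cls_qd_r a : cls (qd k n (vtx n0 a)) = hD * he a.
Proof.
have := arrows_qe (a + 1) false; rewrite addrK /he /hD -clsM // => ->.
by rewrite /qd vup_vtx.
Qed.

Lemma he_mul a b : he a * he b = if vtx n0 a == vtx n0 b then he a else 0.
Proof.
rewrite /he -clsM // qbasis_mul /= /tgt /=.
case: eqP => _; last by rewrite clsZ ?scale0r //; apply: fin_supp_qe.
by congr cls; apply/funext => p; rewrite /qscale mul1r.
Qed.

Lemma he_sum : \sum_(i < n) he (i : nat) = 1.
Proof.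
have -> : (1 : H) = cls (qone k n0) by [].
have E : forall m, (m <= n)%N -> \sum_(i < m) he (i : nat) =
    cls (fun p => ((p.1 < m)%N && (p.2 == [::]))%:R) /\
    fin_supp n (fun p => ((p.1 < m)%N && (p.2 == [::]))%:R : k).
  elim=> [|m IH] lt_m.
    by rewrite big_ord0; split; last by exists 0%N.
  have [Em Fm] := IH (ltnW lt_m).
  rewrite big_ord_recr /= Em /he vtx_nat // -clsD //; last exact: fin_supp_qbasis.
  have -> : (fun p => ((p.1 < m.+1)%N && (p.2 == [::]))%:R) =
      qadd (fun p => ((p.1 < m)%N && (p.2 == [::]))%:R) (qe k m).
    apply/funext => -[v w]; rewrite /qadd /qe /qbasis xpair_eqE /= ltnS leq_eqVlt.
    case: (v =P m) => [->|_]; rewrite ?ltnn /= ?add0r ?addr0 //.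
  by split=> //; apply: fin_suppD => //; apply: fin_supp_qbasis.
by have [->] := E n (leqnn n).
Qed.

(** The idempotent at the start already selects the summand of every later [U] or [D], so the rest
    of the path can be written as a word in [U] and [D]. *)
Lemma cls_path a w : cls (qbasis k (vtx n0 a, w)) =
  he a * \prod_(b <- w) (if b then hU else hD).
Proof.
elim: w a => [|b w IH] a; first by rewrite big_nil mulr1.
rewrite (@qbasis_cons k n0) qstep_vtx clsM ?IH; try exact/fin_supp_qbasis/vtx_lt.
rewrite big_cons !mulrA; congr (_ * _); case: b => //=.
  by rewrite cls_qu_r -mulrA he_mul eqxx -cls_qu_r cls_qu_l.
rewrite -{1}(subrK 1 a) -vup_vtx -/(qd k n _) cls_qd_r -mulrA he_mul eqxx -cls_qd_r cls_qd_l.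
by rewrite subrK.
Qed.

Lemma he_U a : he a * hU = hU * he (a + 1). Proof. by rewrite -cls_qu_l cls_qu_r. Qed.
Lemma hD_e a : hD * he a = he (a + 1) * hD. Proof. by rewrite -cls_qd_r cls_qd_l. Qed.

Lemma halg_ind (P : H -> Prop) : (forall x y, P x -> P y -> P (x + y)) ->
  (forall c a w, P (c *: (he a * \prod_(b <- w) (if b then hU else hD)))) -> forall x, P x.
Proof.
move=> PD PW; apply: hind; apply: fin_supp_ind => [|f g Ff Fg Pf Pg|c i w lt_i].
- by have := PW 0 0 [::]; rewrite scale0r.
- by rewrite clsD //; apply: PD.
rewrite clsZ; last exact: fin_supp_qbasis.
by rewrite -(vtx_nat lt_i) cls_path.
Qed.

Local Notation al := (at_vtx alpha).
Local Notation be := (at_vtx beta).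
Local Notation ga := (at_vtx gamma).

Let heK a y : he a * (he a * y) = he a * y.
Proof. by rewrite mulrA he_mul eqxx. Qed.

Let mvU a y : hU * (he a * y) = he (a - 1) * (hU * y).
Proof. by rewrite -{1}(subrK 1 a) mulrA -he_U mulrA. Qed.

Let mvD a y : hD * (he a * y) = he (a + 1) * (hD * y).
Proof. by rewrite mulrA hD_e mulrA. Qed.

Lemma halg_down_up : down_up n0 he hU hD al be ga.
Proof.
have Fu a : fin_supp n (qu k (vtx n0 a)) by exact: fin_supp_qu.
have Fd a : fin_supp n (qd k n (vtx n0 a)) by exact: fin_supp_qd.
split=> //; [by rewrite /he => a b -> | exact: he_mul | exact: he_sum | exact: he_U | exact: hD_e | | | |].
- move=> a; have /cls_eq0 : inI alpha beta gamma (rel1 alpha beta gamma (vord n0 a)).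
    have := inI_gen1 alpha beta gamma (vord n0 a) (fin_qone k n0) (fin_qone k n0).
    by rewrite qmulq1 ?qmul1q //; apply: fin_supp_rel1.
  move=> /(_ (fin_supp_rel1 _ _ _ _)); rewrite /rel1 /= vdown_vtx vup_vtx.
  rewrite !(clsD, clsM, clsN, clsZ) //;
    try by do ?[apply: fin_suppD | apply: fin_suppN | apply: fin_suppZ | apply: fin_suppM].
  rewrite -/(al a) -/(be a) -/(ga a).
  (* All idempotents travel to the left end, where they coincide and merge into one. *)
  rewrite !cls_qd_l !cls_qu_l -!mulrA !(mvU, mvD, addrK, subrK, heK) => /eqP.
  by rewrite subr_eq0 addrA => /eqP.
- move=> a; have /cls_eq0 : inI alpha beta gamma (rel2 alpha beta gamma (vord n0 a)).
    have := inI_gen2 alpha beta gamma (vord n0 a) (fin_qone k n0) (fin_qone k n0).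
    by rewrite qmulq1 ?qmul1q //; apply: fin_supp_rel2.
  move=> /(_ (fin_supp_rel2 _ _ _ _)); rewrite /rel2 /= vdown_vtx vup_vtx.
  rewrite !(clsD, clsM, clsN, clsZ) //;
    try by do ?[apply: fin_suppD | apply: fin_suppN | apply: fin_suppZ | apply: fin_suppM].
  rewrite -/(al a) -/(be a) -/(ga a).
  rewrite !cls_qd_l !cls_qu_l -!mulrA !(mvU, mvD, addrK, subrK, heK) => /eqP.
  rewrite subr_eq0 addrA => /eqP E.
  (* The axiom has its idempotent on the right; it is brought to the left end to match the relation
     just obtained. *)
  have mvU1 b : hU * he b = he (b - 1) * hU by have := mvU b 1; rewrite !mulr1.
  by rewrite !(mvU1, hD_e, mvU, mvD, addrK, subrK, heK).
- move=> P PD PZ Pe PU PDd; apply: halg_ind => // c a w; apply: PZ.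
  elim: w a => [|b w IH] a; first by rewrite big_nil mulr1.
  rewrite big_cons mulrA; case: b; first by rewrite he_U -mulrA; apply/PU/IH.
  by rewrite -{1}(subrK 1 a) -hD_e -mulrA; apply/PDd/IH.
move=> P PD PZ Pe PU PDd; apply: halg_ind => // c a w; apply: PZ.
elim/last_ind: w => [|w b IH]; first by rewrite big_nil mulr1.
by rewrite big_rcons mulrA; case: b; [apply: PU | apply: PDd].
Qed.

End QuiverDownUp.

(** * The weight representation on the quotient algebra *)

Section QuotientAction.
Variables (k : fieldType) (n0 : nat).
Local Notation n := n0.+1.
Variables alpha beta gamma : 'I_n -> k.
Local Notation H := (halg alpha beta gamma).
Local Notation cls := (cls alpha beta gamma).
Local Notation e := (he alpha beta gamma).
Local Notation U := (hU alpha beta gamma).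
Local Notation D := (hD alpha beta gamma).
Variables (K : comNzRingType) (phi : {rmorphism k -> K}) (mu nu : int -> K).
Hypothesis mu_defect : forall a, mu a * weight_defect phi mu nu alpha beta gamma a = 0.
Hypothesis nu_defect : forall a, nu a * weight_defect phi mu nu alpha beta gamma a = 0.
Implicit Types (x y : H) (psi : int -> K) (a b : int).

Definition hact x : (int -> K) -> int -> K := act n0 phi mu nu (hrep x).

Lemma hact_cls f : fin_supp n f -> hact (cls f) = act n0 phi mu nu f.
Proof.
move=> Ff; apply/funext => psi; apply/funext => a.
have [_] := act_inI mu_defect nu_defect psi a (cls_hrep alpha beta gamma Ff).
rewrite actD ?actN1 //; try exact: fin_suppN; last exact: fin_hrep.
by move/eqP; rewrite subr_eq0 => /eqP.
Qed.

Lemma hactD x y psi a : hact (x + y) psi a = hact x psi a + hact y psi a.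
Proof.
rewrite -[x]hrepK -[y]hrepK -clsD ?hact_cls ?actD //;
  by try apply: fin_suppD; apply: fin_hrep.
Qed.

Lemma hactZ c x psi a : hact (c *: x) psi a = phi c * hact x psi a.
Proof.
by rewrite -[x]hrepK -clsZ ?hact_cls ?actZ //; try apply: fin_suppZ; apply: fin_hrep.
Qed.

Lemma hactM x y psi a : hact (x * y) psi a = hact x (hact y psi) a.
Proof.
rewrite -[x]hrepK -[y]hrepK -clsM ?hact_cls ?act_mul //;
  by try apply: fin_suppM; apply: fin_hrep.
Qed.

Lemma hact0 psi a : hact 0 psi a = 0.
Proof. by rewrite -(scale0r (0 : H)) hactZ rmorph0 mul0r. Qed.

Lemma hactN x psi a : hact (- x) psi a = - hact x psi a.
Proof. by rewrite -scaleN1r hactZ rmorphN1 mulN1r. Qed.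

Lemma hact_e b psi a : hact (e b) psi a = (vtx n0 a == vtx n0 b)%:R * psi a.
Proof. by rewrite hact_cls ?act_qe //; apply: fin_supp_qe. Qed.

Lemma hact_eM x psi a : hact (e a * x) psi a = hact x psi a.
Proof. by rewrite hactM hact_e eqxx mul1r. Qed.

Lemma hact_U psi a : hact U psi a = mu a * psi (a + 1).
Proof.
by rewrite -hact_eM -cls_qu_l hact_cls ?act_qu ?eqxx ?mul1r //; apply: fin_supp_qu.
Qed.

Lemma hact_D psi a : hact D psi a = nu (a - 1) * psi (a - 1).
Proof.
rewrite -hact_eM -{1}(subrK 1 a) -cls_qd_l hact_cls ?act_qd ?subrK ?eqxx ?mul1r //.
exact: fin_supp_qd.
Qed.

Lemma hact_vec0 x a : hact x (fun=> 0) a = 0.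
Proof. by rewrite /hact /act /actN big1 // => l _; rewrite big1 // => w _; rewrite !mulr0. Qed.

Lemma hact_X psi a : hact (U * D) psi a = mu a * nu a * psi a.
Proof. by rewrite hactM hact_U hact_D addrK mulrA. Qed.

Lemma hact_Y psi a : hact (D * U) psi a = mu (a - 1) * nu (a - 1) * psi a.
Proof. by rewrite hactM hact_D hact_U subrK mulrCA mulrA. Qed.

End QuotientAction.

(** * Noetherianity *)

Section Dickson.

(** For a preorder this is the well-quasi-order property, phrased through finite bases of arbitrary
    subsets. *)
Definition finite_basis (T : eqType) (le : T -> T -> Prop) : Prop :=
  forall P : T -> Prop, exists s : seq T, (forall x, x \in s -> P x) /\
    forall x, P x -> exists2 y, y \in s & le y x.

Lemma finite_basis_fin (T : finType) : finite_basis (fun x y : T => x = y).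
Proof.
move=> P; exists [seq x <- enum T | `[< P x >]]; split=> [x|x Px].
  by rewrite mem_filter => /andP[/asboolP].
by exists x => //; rewrite mem_filter mem_enum andbT; apply/asboolP.
Qed.

(** A basis of the projection to [T] lifts to pairs whose second entry is at most some [N]; these
    lie below every pair with second entry at least [N]. Each of the [N] remaining slices has a
    basis of its own. *)
Lemma finite_basis_nat (T : eqType) (le : T -> T -> Prop) : finite_basis le ->
  finite_basis (fun x y : T * nat => le x.1 y.1 /\ (x.2 <= y.2)%N).
Proof.
move=> leT P; have [s [Ps minP]] := leT (fun x => exists i, P (x, i)).
have [N sN] : exists N, forall x, x \in s -> exists2 i, (i <= N)%N & P (x, i).
  elim: s Ps {minP} => [|x s IH] Ps; first by exists 0%N.
  have [|N sN] := IH; first by move=> y sy; apply: Ps; rewrite in_cons sy orbT.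
  have [i Pi] := Ps x (mem_head _ _); exists (maxn i N) => y.
  rewrite in_cons => /predU1P[->|/sN[j le_j Pj]]; first by exists i; rewrite ?leq_maxl.
  by exists j; rewrite // (leq_trans le_j) ?leq_maxr.
have slice : forall M, exists t : seq (T * nat), (forall x, x \in t -> P x) /\
    forall x, P x -> (x.2 < M)%N -> exists2 y, y \in t & le y.1 x.1 /\ (y.2 <= x.2)%N.
  elim=> [|M [t [Pt mint]]]; first by exists [::].
  have [u [Pu minu]] := leT (fun x => P (x, M)).
  exists ([seq (x, M) | x <- u] ++ t); split=> [x|[x i] Px /=].
    by rewrite mem_cat => /orP[/mapP[y uy ->]|/Pt //]; apply: Pu.
  rewrite ltnS leq_eqVlt => /predU1P[iM|lt_i].
    rewrite iM in Px *; have [y uy le_yx] := minu _ Px.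
    by exists (y, M); rewrite //= mem_cat map_f.
  by have [y ty ley] := mint _ Px lt_i; exists y; rewrite // mem_cat ty orbT.
have [t [Pt mint]] := slice N.
have /choice[w Pw] : forall x, exists i, x \in s -> (i <= N)%N /\ P (x, i).
  move=> x; case: (boolP (x \in s)) => [/sN[i le_i Pi]|_]; last by exists 0%N.
  by exists i.
exists ([seq (x, w x) | x <- s] ++ t); split=> [x|[x i] Px].
  by rewrite mem_cat => /orP[/mapP[y /Pw[_ ?] ->]|/Pt].
have [le_N|lt_N] := leqP N i; last first.
  by have [y ty ley] := mint _ Px lt_N; exists y; rewrite // mem_cat ty orbT.
have [|y sy le_yx] := minP x; first by exists i.
exists (y, w y); first by rewrite mem_cat map_f.
by split=> //=; case: (Pw _ sy) => le_w _; apply: leq_trans le_N.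
Qed.

End Dickson.

Section LexOrder.

(** A triple [(m, p, q)] stands for [X^p Y^q Z^m]. The exponent of [Z] decides first, because moving
    a polynomial across [Z^m] keeps [m] but gives no control over [p] and [q]. *)
Definition lexlt (x y : nat * nat * nat) : bool :=
  (x.1.1 < y.1.1)%N || (x.1.1 == y.1.1) &&
  ((x.1.2 < y.1.2)%N || (x.1.2 == y.1.2) && (x.2 < y.2)%N).

Lemma lexlt_ind (P : nat * nat * nat -> Prop) :
  (forall x, (forall y, lexlt y x -> P y) -> P x) -> forall x, P x.
Proof.
move=> step [[m p] q]; elim/ltn_ind: m p q => m IHm p.
elim/ltn_ind: p => p IHp q; elim/ltn_ind: q => q IHq.
apply: step => -[[m' p'] q']; rewrite /lexlt /=.
case/orP=> [lt_m|/andP[/eqP-> /orP[lt_p|/andP[/eqP-> lt_q]]]].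
- exact: IHm.
- exact: IHp.
- exact: IHq.
Qed.

Lemma lexlt_trans y x z : lexlt x y -> lexlt y z -> lexlt x z.
Proof. by rewrite /lexlt; case: x y z => [[? ?] ?] [[? ?] ?] [[? ?] ?] /=; lia. Qed.

Lemma lexlt_total x y : [\/ lexlt x y, x = y | lexlt y x].
Proof.
case: x y => [[m p] q] [[m' p'] q'].
have [H|H] := boolP (lexlt (m, p, q) (m', p', q')); first exact: Or31.
have [H'|H'] := boolP (lexlt (m', p', q') (m, p, q)); first exact: Or33.
apply: Or32; move: H H'; rewrite /lexlt /= => H H'.
have [-> [-> ->]] : m = m' /\ p = p' /\ q = q' by lia.
by [].
Qed.

End LexOrder.

Section Span.
Variables (k : fieldType) (A : algType k).
Implicit Types (G : A -> Prop) (x y : A).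

Inductive lspan G : A -> Prop :=
  | lspan0 : lspan G 0
  | lspanS c g x : G g -> lspan G x -> lspan G (c *: g + x).

Lemma lspanD G x y : lspan G x -> lspan G y -> lspan G (x + y).
Proof.
move=> Gx Gy; elim: Gx => [|c g z Gg _ IH]; first by rewrite add0r.
by rewrite -addrA; apply: lspanS.
Qed.

Lemma lspan_gen G x : G x -> lspan G x.
Proof. by move=> Gx; rewrite -[x]addr0 -[x]scale1r; apply: lspanS => //; apply: lspan0. Qed.

Lemma lspanZ G c x : lspan G x -> lspan G (c *: x).
Proof.
elim=> [|d g y Gg _ IH]; first by rewrite scaler0; apply: lspan0.
by rewrite scalerDr scalerA; apply: lspanS.
Qed.

Lemma lspanN G x : lspan G x -> lspan G (- x).
Proof. by rewrite -scaleN1r; apply: lspanZ. Qed.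

Lemma lspan_mull a G G' x : (forall g, G g -> lspan G' (a * g)) -> lspan G x -> lspan G' (a * x).
Proof.
move=> GG'; elim=> [|c g y Gg _ IH]; first by rewrite mulr0; apply: lspan0.
by rewrite mulrDr -scalerAr; apply: lspanD => //; apply/lspanZ/GG'.
Qed.

Lemma lspan_mulr a G G' x : (forall g, G g -> lspan G' (g * a)) -> lspan G x -> lspan G' (x * a).
Proof.
move=> GG'; elim=> [|c g y Gg _ IH]; first by rewrite mul0r; apply: lspan0.
by rewrite mulrDl -scalerAl; apply: lspanD => //; apply/lspanZ/GG'.
Qed.

Lemma lspan_sub G G' x : (forall g, G g -> lspan G' g) -> lspan G x -> lspan G' x.
Proof. by move=> GG' Gx; rewrite -[x]mul1r; apply: lspan_mull Gx => g /GG'; rewrite mul1r. Qed.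

End Span.

(** * The commutative subalgebra generated by X and Y, and its passage across U and D *)

Section NormalForm.
Variables (k : fieldType) (n0 : nat) (A : algType k) (e : int -> A) (U D : A).
Variables (al be ga : int -> k).
Hypothesis DU : down_up n0 e U D al be ga.
Local Notation n := n0.+1.
Local Notation X := (U * D).
Local Notation Y := (D * U).
Implicit Types (x y r : A) (a b j : int).

Lemma e_decomp x : x = \sum_(i < n) x * e (i : nat).
Proof. by rewrite -mulr_sumr (du_e1 DU) mulr1. Qed.

Lemma eq_from_e x y : (forall a, x * e a = y * e a) -> x = y.
Proof. by move=> E; rewrite [x]e_decomp [y]e_decomp; apply: eq_bigr => i _. Qed.

Lemma e_X a : e a * X = X * e a.
Proof. by rewrite mulrA (du_eU DU) -!mulrA (du_De DU). Qed.

Lemma e_Y a : e a * Y = Y * e a.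
Proof. by rewrite -{1}(subrK 1 a) mulrA -(du_De DU) -mulrA (du_eU DU) subrK mulrA. Qed.

Lemma YU a : Y * U * e a = al (a - 1) *: (X * U * e a) + be (a - 1) *: (U * X * e a)
  + ga (a - 1) *: (U * e a).
Proof.
have := du_DUU DU (a - 1); rewrite -[D * U * U]/(Y * U) -[U * D * U]/(X * U).
rewrite -[U * U * D]mulrA.
have mv Z : e (a - 1) * (Z * U) = e (a - 1) * Z * U by rewrite mulrA.
have eX : forall m, m \in [:: X; Y] -> e (a - 1) * (m * U) = m * U * e a.
  move=> m; rewrite !inE => /orP[]/eqP->;
  by rewrite [LHS]mulrA (e_X, e_Y) -mulrA (du_eU DU) subrK !mulrA.
rewrite !eX ?inE ?eqxx ?orbT // [e _ * (U * _)]mulrA (du_eU DU) subrK.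
by rewrite -[U * e a * _]mulrA e_X [U * (_ * e a)]mulrA => ->.
Qed.

Lemma DY a : D * Y * e a = al a *: (Y * D * e a) + be a *: (X * D * e a) + ga a *: (D * e a).
Proof. by rewrite mulrA (du_DDU DU). Qed.

(** Expanding [X Y] as [U (D Y)] by one relation and [Y X] as [(Y U) D] by the other yields the same
    three terms. *)
Lemma XY_comm : X * Y = Y * X.
Proof.
apply: eq_from_e => a.
have -> : X * Y * e a = U * (D * Y * e a) by rewrite !mulrA.
have -> : Y * X * e a = Y * U * e (a + 1) * D by rewrite -!mulrA (du_De DU).
rewrite DY YU addrK !mulrDr !mulrDl -!scalerAr -!scalerAl -!mulrA !(du_De DU).
by rewrite !mulrA.
Qed.

(** Locked, so that rewriting with associativity leaves monomials intact. *)
Definition mon (p q : nat) : A := locked (X ^+ p * Y ^+ q).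
Lemma monE p q : mon p q = X ^+ p * Y ^+ q.
Proof. by rewrite /mon -lock. Qed.

Definition is_mon x : Prop := exists p q, x = mon p q.

Lemma mon_mul p q p' q' : mon p q * mon p' q' = mon (p + p') (q + q').
Proof.
rewrite !monE !exprD -!mulrA; congr (_ * _); rewrite !mulrA; congr (_ * _).
by apply: commrX; apply/commr_sym/commrX; rewrite /GRing.comm XY_comm.
Qed.

Definition inR := lspan is_mon.

Lemma inR_mon p q : inR (mon p q).
Proof. by apply: lspan_gen; exists p, q. Qed.

Lemma inRM x y : inR x -> inR y -> inR (x * y).
Proof.
move=> Rx Ry; move: Rx; apply: lspan_mulr => _ [p [q ->]]; move: Ry.
by apply: lspan_mull => _ [p' [q' ->]]; rewrite mon_mul; apply: inR_mon.
Qed.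

Lemma inR1 : inR 1. Proof. by have := inR_mon 0 0; rewrite monE mulr1. Qed.
Lemma inRX : inR X. Proof. by have := inR_mon 1 0; rewrite monE mulr1. Qed.
Lemma inRY : inR Y. Proof. by have := inR_mon 0 1; rewrite monE mul1r. Qed.

Lemma e_inR a r : inR r -> e a * r = r * e a.
Proof.
elim=> [|c g y [p [q ->]] _ IH]; first by rewrite mulr0 mul0r.
rewrite mulrDr mulrDl IH -scalerAr -scalerAl; congr (_ *: _ + _).
rewrite monE mulrA; have -> : e a * X ^+ p = X ^+ p * e a by apply/commrX/e_X.
by rewrite -!mulrA; congr (_ * _); apply/commrX/e_Y.
Qed.

Lemma inR_ind (P : A -> Prop) : (forall c, P (c *: 1)) -> P X -> P Y ->
  (forall x y, P x -> P y -> P (x + y)) -> (forall x y, inR x -> inR y -> P x -> P y -> P (x * y)) ->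
  forall r, inR r -> P r.
Proof.
move=> P1 PX PY PD PM r; elim=> [|c g y [p [q ->]] _ IH].
  by have := P1 0; rewrite scale0r.
have RX i : inR (X ^+ i) by have := inR_mon i 0; rewrite monE mulr1.
have RY i : inR (Y ^+ i) by have := inR_mon 0 i; rewrite monE mul1r.
apply: PD => //; rewrite -[mon _ _]mul1r scalerAl; apply: (@PM) => //.
- by apply/lspanZ/inR1.
- exact: inR_mon.
rewrite monE.
have PX_ i : P (X ^+ i).
  elim: i => [|i IHi]; first by have := P1 1; rewrite scale1r.
  by rewrite exprS; apply: (@PM) => //; apply: inRX.
have PY_ i : P (Y ^+ i).
  elim: i => [|i IHi]; first by have := P1 1; rewrite scale1r.
  by rewrite exprS; apply: (@PM) => //; apply: inRY.
exact: (@PM).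
Qed.

(** The polynomial that emerges on the other side of [Z] depends on the vertex, as the structure
    constants do; the idempotent [e j] fixes that vertex. *)
Definition pull_right (Z : A) := forall r j, inR r -> exists2 r', inR r' & r * Z * e j = Z * r' * e j.
Definition pull_left (Z : A) := forall r j, inR r -> exists2 r', inR r' & Z * r * e j = r' * Z * e j.

Lemma pull_rightP Z s : (forall b, e b * Z = Z * e (b + s)) ->
  (forall j, exists2 r', inR r' & X * Z * e j = Z * r' * e j) ->
  (forall j, exists2 r', inR r' & Y * Z * e j = Z * r' * e j) -> pull_right Z.
Proof.
move=> eZ PX PY r j; move: r; apply: inR_ind => // [c|x y|x y Rx Ry].
- by exists (c *: 1); [apply/lspanZ/inR1 | rewrite -!scalerAl mul1r -scalerAr mulr1 -scalerAl].
- move=> [r Rr Er] [r' Rr' Er']; exists (r + r'); first exact: lspanD.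
  by rewrite mulrDl mulrDl Er Er' mulrDr mulrDl.
move=> [r Rr Er] [r' Rr' Er']; exists (r * r'); first exact: inRM.
rewrite -!mulrA [y * _]mulrA Er' -mulrA -(e_inR _ Rr') [x * _]mulrA [x * Z * _]mulrA Er.
by rewrite -!mulrA (e_inR _ Rr').
Qed.

Lemma pull_leftP Z s : (forall b, e b * Z = Z * e (b + s)) ->
  (forall j, exists2 r', inR r' & Z * X * e j = r' * Z * e j) ->
  (forall j, exists2 r', inR r' & Z * Y * e j = r' * Z * e j) -> pull_left Z.
Proof.
move=> eZ PX PY r j; move: r; apply: inR_ind => // [c|x y|x y Rx Ry].
- by exists (c *: 1); [apply/lspanZ/inR1 | rewrite -!scalerAr mulr1 -!scalerAl mul1r].
- move=> [r Rr Er] [r' Rr' Er']; exists (r + r'); first exact: lspanD.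
  by rewrite mulrDr mulrDl Er Er' mulrDl mulrDl.
move=> [r Rr Er] [r' Rr' Er']; exists (r * r'); first exact: inRM.
rewrite -!mulrA -(e_inR _ Ry) [x * _]mulrA [Z * _]mulrA [Z * _]mulrA Er.
by rewrite -!mulrA (e_inR _ Ry) [Z * _]mulrA Er' -!mulrA.
Qed.

Hypothesis be_neq0 : forall a, be a != 0.

Lemma pull_right_U : pull_right U.
Proof.
apply: (pull_rightP (du_eU DU)) => j.
  by exists Y; [apply: inRY | rewrite !mulrA].
exists (al (j - 1) *: Y + be (j - 1) *: X + ga (j - 1) *: 1).
  by do !apply: lspanD; apply: lspanZ; [apply: inRY | apply: inRX | apply: inR1].
by rewrite YU !mulrDr !mulrDl -!scalerAr mulr1 -!scalerAl !mulrA.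
Qed.

Lemma pull_left_D : pull_left D.
Proof.
have eD b : e b * D = D * e (b + -1) by rewrite (du_De DU) subrK.
apply: (pull_leftP eD) => j.
  by exists Y; [apply: inRY | rewrite !mulrA].
exists (al j *: Y + be j *: X + ga j *: 1).
  by do !apply: lspanD; apply: lspanZ; [apply: inRY | apply: inRX | apply: inR1].
by rewrite DY !mulrDl -!scalerAl mul1r ?mulrA.
Qed.

Let addr3K (x y z : A) : x + y + z - x - z = y.
Proof. by rewrite addrAC addrK addrC addKr. Qed.

(** [U Y] is [X U], while [U X] appears in the relation for [Y U] with a factor beta: solving for it
    divides by beta. *)
Lemma pull_left_U : pull_left U.
Proof.
apply: (pull_leftP (du_eU DU)) => j; last first.
  by exists X; [apply: inRX | rewrite !mulrA].
exists ((be (j - 1))^-1 *: (Y - al (j - 1) *: X - ga (j - 1) *: 1)).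
  by apply: lspanZ; do !apply: lspanD; rewrite -?scaleNr; try apply: lspanN; try apply: lspanZ;
     [apply: inRY | apply: inRX | apply: inR1].
rewrite -!scalerAl !mulrBl -!scalerAl mul1r YU addr3K scalerA mulVf // scale1r.
by [].
Qed.

(** [Y D] is [D X], and [X D] is obtained from the relation for [D Y] by dividing by beta. *)
Lemma pull_right_D : pull_right D.
Proof.
have eD b : e b * D = D * e (b + -1) by rewrite (du_De DU) subrK.
apply: (pull_rightP eD) => j; last first.
  by exists X; [apply: inRX | rewrite !mulrA].
exists ((be j)^-1 *: (Y - al j *: X - ga j *: 1)).
  by apply: lspanZ; do !apply: lspanD; rewrite -?scaleNr; try apply: lspanN; try apply: lspanZ;
     [apply: inRY | apply: inRX | apply: inR1].
rewrite -!scalerAr -!scalerAl !mulrBr !mulrBl -!scalerAr mulr1 -!scalerAl DY [D * (U * D)]mulrA.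
by rewrite addr3K scalerA mulVf // scale1r.
Qed.

End NormalForm.

Definition right_noetherian (A : nzRingType) : Prop :=
  forall J : A -> Prop, J 0 -> (forall x y, J x -> J y -> J (x + y)) ->
    (forall x a, J x -> J (x * a)) ->
  exists gs : seq A, (forall j, (j < size gs)%N -> J gs`_j) /\
    forall x, J x -> exists as_ : seq A, x = \sum_(j < size gs) gs`_j * as_`_j.

Inductive right_span (A : nzRingType) (gs : seq A) : A -> Prop :=
  | right_span0 : right_span gs 0
  | right_spanS g a x : g \in gs -> right_span gs x -> right_span gs (g * a + x).

Section RightSpan.
Variable A : nzRingType.
Implicit Types (gs : seq A) (x y a : A).

Lemma right_spanD gs x y : right_span gs x -> right_span gs y -> right_span gs (x + y).
Proof.
move=> Gx Gy; elim: Gx => [|g a z Gg _ IH]; first by rewrite add0r.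
by rewrite -addrA; apply: right_spanS.
Qed.

Lemma right_span_gen gs g a : g \in gs -> right_span gs (g * a).
Proof. by move=> Gg; rewrite -[_ * a]addr0; apply: right_spanS => //; apply: right_span0. Qed.

Lemma right_span_sub gs gs' x : {subset gs <= gs'} -> right_span gs x -> right_span gs' x.
Proof.
move=> sub; elim=> [|g a z Gg _ IH]; first exact: right_span0.
by apply: right_spanS => //; apply: sub.
Qed.

Lemma right_spanP gs x : right_span gs x ->
  exists as_ : seq A, x = \sum_(j < size gs) gs`_j * as_`_j.
Proof.
elim=> [|g a z Gg _ [as_ ->]].
  by exists [::]; rewrite big1 // => j _; rewrite nth_nil mulr0.
have lt_i : (index g gs < size gs)%N by rewrite index_mem.
(* The new coefficient is added at the first occurrence of [g] in [gs]. *)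
exists (mkseq (fun j => as_`_j + a *+ (j == index g gs)) (size gs)).
under [RHS]eq_bigr => j _ do rewrite nth_mkseq // mulrDr.
rewrite big_split addrC /=; congr (_ + _); symmetry.
rewrite (bigD1 (Ordinal lt_i)) //= eqxx mulr1n nth_index // big1 ?addr0 // => j ne_j.
by rewrite -val_eqE /= in ne_j; rewrite (negbTE ne_j) mulr0n mulr0.
Qed.

End RightSpan.

(** * One stage of the Groebner-type reduction *)

Section Stage.
Variables (k : fieldType) (n0 : nat) (A : algType k) (e : int -> A) (U D : A).
Variables (al be ga : int -> k).
Hypothesis DU : down_up n0 e U D al be ga.
Local Notation n := n0.+1.
Local Notation X := (U * D).
Local Notation Y := (D * U).
Local Notation mon := (mon U D).
Local Notation inR := (inR U D).
Implicit Types (x y r f g : A) (b j : int).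

(* Z is the letter whose degree is lowered, s its shift of vertices, and [E j]
   spans the error terms that this process leaves in A e_j. *)
Variables (Z : A) (s : int) (E : int -> A -> Prop).
Hypothesis eZ : forall b, e b * Z = Z * e (b + s).
Hypothesis pullr : pull_right e U D Z.
Hypothesis pulll : pull_left e U D Z.

Lemma e_Zexp m b : e b * Z ^+ m = Z ^+ m * e (b + s * m%:Z).
Proof.
elim: m b => [|m IH] b; first by rewrite mulr0 addr0 mulr1 mul1r.
by rewrite exprS mulrA eZ -mulrA IH mulrA -addrA intS mulrDr mulr1.
Qed.

Lemma pullr_exp m r j : inR r -> exists2 r', inR r' & r * Z ^+ m * e j = Z ^+ m * r' * e j.
Proof.
elim: m r j => [|m IH] r j Rr; first by exists r => //; rewrite mulr1 mul1r.
have [r1 Rr1 E1] := IH r (j - s) Rr; have [r2 Rr2 E2] := pullr j Rr1.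
exists r2 => //; transitivity (r * Z ^+ m * e (j - s) * Z).
  by rewrite exprSr -!mulrA eZ subrK.
rewrite E1; transitivity (Z ^+ m * (r1 * Z * e j)); first by rewrite -!mulrA eZ subrK.
by rewrite E2 exprSr !mulrA.
Qed.

Lemma pulll_exp m r j : inR r -> exists2 r', inR r' & Z ^+ m * r * e j = r' * Z ^+ m * e j.
Proof.
elim: m r j => [|m IH] r j Rr; first by exists r => //; rewrite mulr1 mul1r.
have [r1 Rr1 E1] := pulll j Rr; have [r2 Rr2 E2] := IH r1 (j - s) Rr1.
exists r2 => //; transitivity (Z ^+ m * (Z * r * e j)); first by rewrite exprSr !mulrA.
rewrite E1; transitivity (Z ^+ m * r1 * e (j - s) * Z); first by rewrite -!mulrA eZ subrK.
by rewrite E2 -!mulrA eZ subrK exprSr -!mulrA.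
Qed.

Definition zmon (t : nat * nat * nat) j := mon t.1.2 t.2 * Z ^+ t.1.1 * e j.

Definition stage_gen j g := E j g \/ exists t, g = zmon t j.
Definition low_gen t j g := E j g \/ exists2 t', lexlt t' t & g = zmon t' j.
(** Monic with leading monomial [t], up to error terms. As linear independence of the monomials is
    not asserted, an element may have several leads. *)
Definition has_lead t j g := lspan (low_gen t j) (g - zmon t j).

Hypothesis E_period : forall j j' g, vtx n0 j = vtx n0 j' -> E j g -> E j' g.
Hypothesis E_mulR : forall j g r, inR r -> E j g -> lspan (E j) (g * r).
Hypothesis E_mulZ : forall j g, E j g ->
  lspan (fun h => E (j + s) h \/ exists p q, h = mon p q * e (j + s)) (g * Z).

Lemma zmon_mulZ t j : zmon t j * Z = zmon (t.1.1.+1, t.1.2, t.2) (j + s).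
Proof. by rewrite /zmon -mulrA eZ mulrA -(mulrA (mon _ _)) -exprSr. Qed.

(** Multiplied by [Z], an error term may drop into degree 0 in [Z]; this is still below the new
    leading monomial, whose degree is positive. *)
Lemma has_leadZ m p q j g : has_lead (m, p, q) j g -> has_lead (m.+1, p, q) (j + s) (g * Z).
Proof.
rewrite /has_lead => L; rewrite -[zmon _ _]/(zmon ((m, p, q).1.1.+1, p, q) (j + s)).
rewrite -zmon_mulZ -mulrBl; move: L; apply: lspan_mulr => h [/E_mulZ|[t' lt_t ->]].
  apply: lspan_sub => h' [Eh|[p' [q' ->]]]; apply: lspan_gen; [by left | right].
  by exists (0%N, p', q') => //; rewrite /zmon mulr1.
rewrite zmon_mulZ; apply: lspan_gen; right; eexists; last by [].
by move: lt_t; rewrite /lexlt /=.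
Qed.

Lemma mon_span_Z m r j : inR r -> lspan (fun h => exists p q, h = zmon (m, p, q) j) (r * Z ^+ m * e j).
Proof.
rewrite -mulrA; apply: lspan_mulr => _ [p [q ->]].
by apply: lspan_gen; exists p, q; rewrite mulrA.
Qed.

(** The multiplier [a] is what [X^p1 Y^q1] becomes after crossing [Z^m]. Terms of the same degree in
    [Z] have their exponents shifted alike; terms of smaller degree change arbitrarily but keep that
    degree. *)
Lemma has_leadR m p q p1 q1 j g : has_lead (m, p, q) j g ->
  exists a : A, has_lead (m, p + p1, q + q1)%N j (g * a).
Proof.
move=> L; have [a Ra Ea] := pullr_exp m j (inR_mon U D p1 q1); exists a.
have zE p' q' : zmon (m, p', q') j * a = zmon (m, p' + p1, q' + q1)%N j.
  rewrite /zmon /= -!mulrA (e_inR DU _ Ra) [Z ^+ m * _]mulrA -Ea -(mon_mul DU).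
  by rewrite !mulrA.
rewrite /has_lead -zE -mulrBl; move: L; apply: lspan_mulr => h [Eh|[[[m' p'] q'] lt_t ->]].
  by move: (E_mulR Ra Eh); apply: lspan_sub => h' Eh'; apply: lspan_gen; left.
have [mE|ne_m] := eqVneq m' m.
  rewrite mE zE; apply: lspan_gen; right; eexists; last by [].
  by move: lt_t; rewrite /lexlt /= mE ltnn eqxx /=; lia.
have lt_m : (m' < m)%N by move: lt_t; rewrite /lexlt /=; lia.
have [r Rr Er] := pulll_exp m' j Ra.
have -> : zmon (m', p', q') j * a = mon p' q' * r * Z ^+ m' * e j.
  by rewrite /zmon /= -!mulrA (e_inR DU _ Ra) [Z ^+ m' * _]mulrA Er !mulrA.
have Rr' : inR (mon p' q' * r) by apply: (inRM DU) => //; apply: inR_mon.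
move: (mon_span_Z m' j Rr'); apply: lspan_sub => _ [p2 [q2 ->]].
by apply: lspan_gen; right; exists (m', p2, q2) => //; rewrite /lexlt /= lt_m.
Qed.

Lemma has_lead_period t j j' g : vtx n0 j = vtx n0 j' -> has_lead t j g -> has_lead t j' g.
Proof.
move=> jj'; rewrite /has_lead /zmon (du_eE DU jj'); apply: lspan_sub => h [Eh|[t' lt_t ->]].
  by apply: lspan_gen; left; apply: E_period Eh.
by apply: lspan_gen; right; exists t' => //; rewrite /zmon (du_eE DU jj').
Qed.

(** Since [Z^m e_j] starts at the vertex of [j - s * m], the last condition says that the two
    leading monomials share their start vertex. *)
Lemma has_lead_mono m p q m' p' q' j j' g : has_lead (m, p, q) j g ->
  (m <= m')%N -> (p <= p')%N -> (q <= q')%N ->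
  vtx n0 (j - s * m%:Z) = vtx n0 (j' - s * m'%:Z) ->
  exists a : A, has_lead (m', p', q') j' (g * a).
Proof.
move=> L /subnKC mE /subnKC pE /subnKC qE jj'.
have [a La] := has_leadR (p' - p)%N (q' - q)%N L; rewrite pE qE in La.
have step d : exists b : A, has_lead (m + d, p', q')%N (j + s * d%:Z) (g * a * b).
  elim: d => [|d [b /has_leadZ Lb]].
    by rewrite mulr0 addr0 addn0; exists 1; rewrite mulr1.
  by exists (b * Z); rewrite addnS intS mulrDr mulr1 [s + _]addrC addrA mulrA.
have [b] := step (m' - m)%N; rewrite mE => Lb.
exists (a * b); rewrite mulrA; apply: has_lead_period Lb.
have -> : j + s * (m' - m)%N%:Z = (j - s * m%:Z) + s * m'%:Z.
  by rewrite -{2}mE PoszD; ring.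
by apply/eqP; rewrite -(eq_vtxD _ _ _ (- (s * m'%:Z))) addrK jj'.
Qed.

(** Cancellation among equal monomials is not tracked, so [c] may be zero; the reduction treats that
    case separately. *)
Lemma lead_split t j f : lspan (low_gen t j) f -> lspan (E j) f \/
  exists t' c, lexlt t' t /\ lspan (low_gen t' j) (f - c *: zmon t' j).
Proof.
elim=> [|c g x Gg Lx IH]; first by left; apply: lspan0.
have Elow t' y : lspan (E j) y -> lspan (low_gen t' j) y.
  by apply: lspan_sub => h Eh; apply: lspan_gen; left.
have zlow t1 t2 d : lexlt t1 t2 -> lspan (low_gen t2 j) (d *: zmon t1 j).
  by move=> lt12; apply/lspanZ/lspan_gen; right; exists t1.
case: Gg => [Eg|[t1 lt1 ->]]; case: IH => [Ex|[t2 [d [lt2 Lx2]]]].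
- by left; apply: lspanS.
- right; exists t2, d; split=> //; rewrite -addrA; apply: lspanD => //.
  by apply/Elow/lspanZ/lspan_gen.
- by right; exists t1, c; split=> //; rewrite addrC addKr; apply: Elow.
right; case: (lexlt_total t1 t2) => [lt12|E12|lt21].
- exists t2, d; split=> //; rewrite -addrA; apply: lspanD => //; exact: zlow.
- by exists t2, (c + d); split=> //; rewrite E12 scalerDl opprD addrACA subrr add0r.
exists t1, c; split=> //; rewrite addrC addKr -[x](subrK (d *: zmon t2 j)).
apply: lspanD; last exact: zlow.
move: Lx2; apply: lspan_sub => h [Eh|[t3 lt3 ->]]; apply: lspan_gen; [by left | right].
by exists t3 => //; apply: lexlt_trans lt21.
Qed.

(** Dickson's lemma provides finitely many elements of [J] whose leads divide all leads of [J].
    Subtracting multiples of them lowers the lead of [f] until only error terms remain. *)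
Lemma stage_reduction (J : A -> Prop) : J 0 -> (forall x y, J x -> J y -> J (x + y)) ->
    (forall x a, J x -> J (x * a)) ->
  exists2 gs : seq A, (forall g, g \in gs -> J g) & forall j f, J f ->
    lspan (stage_gen j) f -> exists f', [/\ J f', lspan (E j) f' & right_span gs (f - f')].
Proof.
move=> J0 JD JM; pose T := ('I_n * nat * nat * nat)%type.
(* The first entry of [x] is the start vertex of the leading monomial. It is compared by equality,
   as right multiplication cannot change it. *)
pose wit (x : T) (w : int * A) := [/\ J w.2, has_lead (x.1.1.2, x.1.2, x.2) w.1 w.2 &
  vtx n0 (w.1 - s * x.1.1.2%:Z) = x.1.1.1].
have FB := finite_basis_nat (finite_basis_nat (finite_basis_nat (@finite_basis_fin 'I_n))).
have [ts [Pts mints]] := FB (fun x : T => exists w, wit x w).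
have /choice[w Pw] : forall t : T, exists w, t \in ts -> wit t w.
  move=> t; case: (boolP (t \in ts)) => [/Pts[w Pw]|_]; first by exists w.
  by exists (0, 0).
exists [seq (w t).2 | t <- ts] => [_ /mapP[t /Pw[Jt _ _] ->] //|j f Jf Sf].
set gs := [seq _ | t <- ts].
have JN x : J x -> J (- x) by move=> Jx; rewrite -mulrN1; apply: JM.
have JZ c x : J x -> J (c *: x) by move=> Jx; rewrite -[x]mulr1 scalerAr; apply: JM.
(* Finitely many monomials occur in [f], so all lie below [Z^m] for a large [m]. *)
have [m] : exists m, lspan (low_gen (m, 0%N, 0%N) j) f.
  elim: Sf => [|c g x Gg _ [m Lm]]; first by exists 0%N; apply: lspan0.
  case: Gg => [Eg|[t ->]].
    by exists m; apply: lspanD => //; apply/lspanZ/lspan_gen; left.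
  exists (maxn m t.1.1.+1); apply: lspanD.
    apply/lspanZ/lspan_gen; right; exists t => //.
    by rewrite /lexlt /=; lia.
  move: Lm; apply: lspan_sub => h [Eh|[t' lt' ->]]; apply: lspan_gen; [by left | right].
  by exists t' => //; move: lt'; rewrite /lexlt /=; lia.
move: (m, 0%N, 0%N) => t; elim/lexlt_ind: t f Jf {Sf m} => t IH f Jf Lf.
case: (lead_split Lf) => [Ef|[t' [c [lt' Lc]]]].
  by exists f; split=> //; rewrite subrr; apply: right_span0.
have [c0|c_neq0] := eqVneq c 0.
  by apply: IH lt' _ Jf _; move: Lc; rewrite c0 scale0r subr0.
move: t' lt' Lc => [[m p] q] lt' Lc.
pose x : T := (vord n0 (j - s * m%:Z), m, p, q).
have [|y ts_y [[[y1 y2] y3] y4]] := mints x.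
  exists (j, c^-1 *: f); split=> //=.
    exact: JZ.
  rewrite /has_lead; have := lspanZ c^-1 Lc.
  by rewrite scalerBr scalerA mulVf // scale1r.
have [Jy Ly vy] := Pw _ ts_y.
have [|a La] := has_lead_mono (j' := j) Ly y2 y3 y4; first by rewrite vy y1.
have gs_y : (w y).2 \in gs by apply: map_f.
have Jya := JM _ a Jy; set ya := _ * a in La Jya.
have [||f' [Jf' Ef' Rf']] := IH _ lt' (f - c *: ya).
- by apply/JD/JN/JZ.
- rewrite -(subrK (c *: zmon (m, p, q) j) f) -addrA -scalerBr; apply: lspanD => //.
  by rewrite -[_ - ya]opprB scalerN; apply/lspanN/lspanZ.
exists f'; split=> //.
have -> : f - f' = (w y).2 * (c *: a) + (f - c *: ya - f').
  by rewrite -scalerAr -/ya addrA addrCA subrr addr0.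
exact: right_spanS.
Qed.

End Stage.

Section Noetherian.
Variables (k : fieldType) (n0 : nat) (A : algType k) (e : int -> A) (U D : A).
Variables (al be ga : int -> k).
Hypothesis DU : down_up n0 e U D al be ga.
Hypothesis be_neq0 : forall a, be a != 0.
Local Notation n := n0.+1.
Local Notation mon := (mon U D).

Let eD b : e b * D = D * e (b + -1). Proof. by rewrite (du_De DU) subrK. Qed.

(** The exponent [m.+1] leaves degree 0 to the powers of [U]. *)
Definition neg_gen j (g : A) := exists m p q, g = mon p q * D ^+ m.+1 * e j.

Let pullU_r := pull_right_U DU.
Let pullU_l := pull_left_U DU be_neq0.
Let pullD_r := pull_right_D DU be_neq0.
Let pullD_l := pull_left_D DU.

Lemma neg_span m r j : inR U D r -> lspan (neg_gen j) (r * D ^+ m.+1 * e j).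
Proof.
rewrite -mulrA; apply: lspan_mulr => _ [p [q ->]].
by apply: lspan_gen; exists m, p, q; rewrite mulrA.
Qed.

Lemma neg_genR j g r : inR U D r -> neg_gen j g -> lspan (neg_gen j) (g * r).
Proof.
move=> Rr [m [p [q ->]]].
have [r' Rr' Er'] := pulll_exp eD pullD_l m.+1 j Rr.
have -> : mon p q * D ^+ m.+1 * e j * r = mon p q * r' * D ^+ m.+1 * e j.
  by rewrite -!mulrA (e_inR DU _ Rr) [D ^+ _ * _]mulrA Er' !mulrA.
by apply/neg_span/(inRM DU) => //; apply: inR_mon.
Qed.

(** [D^(m+1) U] is [D^m Y], and [Y] crosses [D^m] to the left; for [m = 0] the result has degree
    0. *)
Lemma neg_genU j g : neg_gen j g ->
  lspan (fun h => neg_gen (j + 1) h \/ exists p q, h = mon p q * e (j + 1)) (g * U).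
Proof.
move=> [m [p [q ->]]].
have [r' Rr' Er'] := pulll_exp eD pullD_l m (j + 1) (inRY U D).
have -> : mon p q * D ^+ m.+1 * e j * U = mon p q * r' * D ^+ m * e (j + 1).
  by rewrite -!mulrA (du_eU DU) exprSr -!mulrA [D * (U * _)]mulrA [D ^+ m * _]mulrA Er' !mulrA.
have Rm : inR U D (mon p q * r') by apply: (inRM DU) => //; apply: inR_mon.
case: m {Er'} => [|m].
  rewrite mulr1; move: Rm; apply: lspan_mulr => _ [p' [q' ->]].
  by apply: lspan_gen; right; exists p', q'.
by move: (neg_span m (j + 1) Rm); apply: lspan_sub => h Nh; apply: lspan_gen; left.
Qed.

Lemma neg_period j j' g : vtx n0 j = vtx n0 j' -> neg_gen j g -> neg_gen j' g.
Proof. by move=> /(du_eE DU) jj' [m [p [q ->]]]; exists m, p, q; rewrite jj'. Qed.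

Local Notation nf_gen := (stage_gen e U D U neg_gen).

Lemma nf_U m r j : inR U D r -> lspan (nf_gen j) (r * U ^+ m * e j).
Proof.
rewrite -mulrA; apply: lspan_mulr => _ [p [q ->]].
by apply: lspan_gen; right; exists (m, p, q); rewrite /zmon mulrA.
Qed.

Lemma nf_D m r j : inR U D r -> lspan (nf_gen j) (r * D ^+ m * e j).
Proof.
case: m => [|m] Rr; first exact: (@nf_U 0).
by move: (neg_span m j Rr); apply: lspan_sub => h Nh; apply: lspan_gen; left.
Qed.

(** A letter multiplied from the left crosses the polynomial part. It then either lengthens a power
    of the same letter or combines with the opposite letter into [X] or [Y]. *)
Lemma normal_form x j : lspan (nf_gen j) (x * e j).
Proof.
(* Crossing the polynomial requires an idempotent right behind it, which is fetched from the far end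
   across [Z'^m]. *)
have mulL Z Z' m p q j1 :
  (forall r j, inR U D r -> exists2 r', inR U D r' & Z * r * e j = r' * Z * e j) ->
  (exists b, Z' ^+ m * e j1 = e b * Z' ^+ m) ->
  exists2 r', inR U D r' & Z * (mon p q * Z' ^+ m * e j1) = r' * Z * Z' ^+ m * e j1.
  move=> pull [b Eb]; have [r' Rr' Er'] := pull _ b (inR_mon U D p q); exists r' => //.
  by rewrite -[mon p q * _ * _]mulrA Eb !mulrA Er' -!mulrA Eb.
have UZ m j1 : exists b, U ^+ m * e j1 = e b * U ^+ m.
  by exists (j1 - 1 * m%:Z); rewrite (e_Zexp (du_eU DU)) subrK.
have DZ m j1 : exists b, D ^+ m * e j1 = e b * D ^+ m.
  by exists (j1 - (-1) * m%:Z); rewrite (e_Zexp eD) subrK.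
move: x j; apply: (du_indl DU) => [x y IHx IHy j|c x IHx j|a j|x IHx j|x IHx j].
- by rewrite mulrDl; apply: lspanD.
- by rewrite -scalerAl; apply: lspanZ.
- rewrite (du_ee DU); case: eqP => [/(du_eE DU) ->|_]; last exact: lspan0.
  by have := @nf_U 0 1 j (inR1 U D); rewrite !mul1r.
- rewrite -mulrA; move: (IHx j); apply: lspan_mull => _ [[m [p [q ->]]]|[[[m p] q] ->]].
    have [r' Rr' ->] := mulL U D m.+1 p q j pullU_l (DZ _ _).
    have -> : r' * U * D ^+ m.+1 * e j = r' * (U * D) * D ^+ m * e j by rewrite exprS !mulrA.
    by apply/nf_D/(inRM DU) => //; apply: inRX.
  rewrite /zmon /=; have [r' Rr' ->] := mulL U U m p q j pullU_l (UZ _ _).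
  by rewrite -[r' * U * _]mulrA -exprS; apply: nf_U.
rewrite -mulrA; move: (IHx j); apply: lspan_mull => _ [[m [p [q ->]]]|[[[m p] q] ->]].
  have [r' Rr' ->] := mulL D D m.+1 p q j pullD_l (DZ _ _).
  by rewrite -[r' * D * _]mulrA -exprS; apply: nf_D.
rewrite /zmon /=; have [r' Rr' ->] := mulL D U m p q j pullD_l (UZ _ _).
case: m => [|m]; first by rewrite mulr1 -[D]expr1; apply: nf_D.
have -> : r' * D * U ^+ m.+1 * e j = r' * (D * U) * U ^+ m * e j by rewrite exprS !mulrA.
by apply/nf_U/(inRM DU) => //; apply: inRY.
Qed.

(* The first stage lowers the degree in U, the second the degree in D. *)
Lemma down_up_right_noetherian : right_noetherian A.
Proof.
move=> J J0 JD JM.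
have [gs Jgs redU] := stage_reduction DU (du_eU DU) pullU_r pullU_l neg_period neg_genR neg_genU J0 JD JM.
(* This stage admits no error terms, so the remainder that it leaves is zero. *)
have [|||gs' Jgs' redD] := stage_reduction (E := fun _ _ => False) DU
  eD pullD_r pullD_l _ _ _ J0 JD JM => //.
have Jgs2 g : g \in gs ++ gs' -> J g by rewrite mem_cat => /orP[/Jgs|/Jgs'].
exists (gs ++ gs'); split=> [j lt_j|x Jx]; first by apply/Jgs2/mem_nth.
apply: right_spanP; rewrite [x](e_decomp DU).
elim/big_ind: _ => [|y z|i _]; [exact: right_span0 | exact: right_spanD |].
have [f [Jf Nf Rf]] := redU _ _ (JM _ (e (i : nat)) Jx) (normal_form x (i : nat)).
have [|f' [Jf' f'0 Rf']] := redD (i : nat) f Jf.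
  move: Nf; apply: lspan_sub => _ [m [p [q ->]]]; apply: lspan_gen; right.
  by exists (m.+1, p, q).
have {f'0} f'0 : f' = 0 by elim: f'0.
rewrite -[x * _](subrK f); apply: right_spanD.
  by apply: right_span_sub Rf => g; rewrite mem_cat => ->.
rewrite -[f]subr0 -f'0; apply: right_span_sub Rf' => g; rewrite mem_cat => ->; exact: orbT.
Qed.

End Noetherian.

(** * Ideals of the path algebra over the relations and ideals of the quotient *)

Section NoetherianTransfer.
Variables (k : fieldType) (n0 : nat).
Local Notation n := n0.+1.
Variables (I : qfun k -> Prop) (op : qfun k -> qfun k -> qfun k).
Variables (A : nzRingType) (c : qfun k -> A) (r : A -> qfun k).
Hypothesis op_fin : forall f g, fin_supp n f -> fin_supp n g -> fin_supp n (op f g).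
Hypothesis cD : forall f g, fin_supp n f -> fin_supp n g -> c (qadd f g) = c f + c g.
Hypothesis cN : forall f, fin_supp n f -> c (qopp f) = - c f.
Hypothesis cM : forall f g, fin_supp n f -> fin_supp n g -> c (op f g) = c f * c g.
Hypothesis c0 : forall f, fin_supp n f -> c f = 0 <-> I f.
Hypothesis r_fin : forall x, fin_supp n (r x).
Hypothesis rK : forall x, c (r x) = x.

Lemma fin_qsum (fs : seq (qfun k)) :
  (forall j, (j < size fs)%N -> fin_supp n (nth (qzero k) fs j)) -> fin_supp n (qsum fs).
Proof.
elim: fs => [|f fs IH] F; first exact: fin_supp0.
by apply: fin_suppD; [apply: (F 0%N) | apply: IH => j; apply: (F j.+1)].
Qed.

Lemma c_qsum (F : nat -> qfun k) m : (forall j, (j < m)%N -> fin_supp n (F j)) ->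
  fin_supp n (qsum [seq F j | j <- iota 0 m]) /\
  c (qsum [seq F j | j <- iota 0 m]) = \sum_(j < m) c (F j).
Proof.
move=> FF; split.
  apply: fin_qsum => j; rewrite size_map size_iota => lt_j.
  by rewrite (nth_map 0%N) ?size_iota // nth_iota //; apply: FF.
rewrite -(big_mkord xpredT (fun j => c (F j))) /index_iota subn0.
have : forall j, j \in iota 0 m -> fin_supp n (F j) by move=> j; rewrite mem_iota => /FF.
have cz : c (qzero k) = 0.
  by have := cD (fin_supp0 k n0) (fin_supp0 k n0); rewrite qadd0 => /eqP; rewrite -subr_eq subrr eq_sym => /eqP.
elim: (iota 0 m) => [|j s IH] Fs; first by rewrite big_nil.
have Fs' i : i \in s -> fin_supp n (F i) by move=> si; apply: Fs; rewrite in_cons si orbT.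
rewrite big_cons /= cD ?IH //; first by apply: Fs; rewrite mem_head.
apply: fin_qsum => i; rewrite size_map => lt_i.
by rewrite (nth_map 0%N) //; apply/Fs'/mem_nth.
Qed.

(** The product [op] is arbitrary so that the reversed product, with the opposite algebra as
    quotient, covers left ideals. *)
Lemma right_noetherian_transfer : right_noetherian A <->
  forall J : qfun k -> Prop, [/\ forall f, J f -> fin_supp n f,
      forall f, fin_supp n f -> I f -> J f,
      forall f g, J f -> J g -> J (qadd f g)
    & forall f a, J f -> fin_supp n a -> J (op f a)] ->
  exists gs : seq (qfun k), (forall j, (j < size gs)%N -> J (nth (qzero k) gs j)) /\
    forall f, J f -> exists as_ : seq (qfun k), size as_ = size gs /\
      (forall j, (j < size as_)%N -> fin_supp n (nth (qzero k) as_ j)) /\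
      I (qadd f (qopp (qsum [seq op (nth (qzero k) gs j) (nth (qzero k) as_ j)
                            | j <- iota 0 (size gs)]))).
Proof.
have Fz := fin_supp0 k n0.
split=> [NA J [JF IJ JD JM]|NA J J0 JD JM].
  pose J' x := exists2 f, J f & c f = x.
  (* The chosen representative differs from an element of [J] by an element of [I], which [J]
     contains. *)
  have Jr x : J' x -> J (r x).
    case=> f Jf cf; have Ff := JF _ Jf.
    have -> : r x = qadd f (qadd (r x) (qopp f)).
      by apply/funext => p; rewrite /qadd /qopp addrCA subrr addr0.
    apply: JD => //; apply: IJ; first by apply: fin_suppD => //; apply: fin_suppN.
    apply/c0; first by apply: fin_suppD => //; apply: fin_suppN.
    by rewrite cD ?cN ?rK ?cf ?subrr //; apply: fin_suppN.
  case: (NA J') => [||x a [f Jf <-]|gs [Jgs Egs]].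
  - by exists (r 0); rewrite ?rK //; apply: IJ => //; apply/c0; rewrite ?rK.
  - by move=> x y [f Jf <-] [g Jg <-]; exists (qadd f g); [apply: JD | rewrite cD //; apply: JF].
  - by exists (op f (r a)); [apply: JM | rewrite cM ?rK //; apply: JF].
  have Jg j : (j < size gs)%N -> J (nth (qzero k) [seq r x | x <- gs] j).
    by move=> lt_j; rewrite (nth_map 0) //; apply/Jr/Jgs.
  exists [seq r x | x <- gs]; split=> [j|f Jf]; first by rewrite size_map => /Jg.
  have [|as_ Eas] := Egs (c f); first by exists f.
  exists (mkseq (fun j => r as_`_j) (size gs)); rewrite !size_mkseq size_map; split=> //.
  have Fa j : (j < size gs)%N ->
      fin_supp n (nth (qzero k) (mkseq (fun j => r as_`_j) (size gs)) j).
    by move=> lt_j; rewrite nth_mkseq.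
  split=> //; have [|Fs Es] := @c_qsum (fun j => op (nth (qzero k) [seq r x | x <- gs] j)
    (nth (qzero k) (mkseq (fun j => r as_`_j) (size gs)) j)) (size gs).
    by move=> j lt_j; apply: op_fin; [apply/JF/Jg | apply: Fa].
  apply/c0; first by apply: fin_suppD; [apply: JF | apply: fin_suppN].
  rewrite cD ?cN //; [|exact: JF|exact: fin_suppN].
  apply/eqP; rewrite subr_eq0 Es Eas; apply/eqP; apply: eq_bigr => j _.
  by rewrite cM ?nth_mkseq // ?(nth_map 0) // ?rK.
case: (NA (fun f => fin_supp n f /\ J (c f))) => [|gs [Jgs Egs]].
  split=> [f []|f Ff /c0 -> //|f g [Ff Jf] [Fg Jg]|f a [Ff Jf] Fa] //.
  - by split; [apply: fin_suppD | rewrite cD //; apply: JD].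
  - by split; [apply: op_fin | rewrite cM //; apply: JM].
exists [seq c g | g <- gs]; rewrite size_map; split=> [j lt_j|x Jx].
  by rewrite (nth_map (qzero k)) //; case: (Jgs j lt_j).
have [|as_ [sz_as [Fa Ia]]] := Egs (r x); first by rewrite rK.
exists [seq c g | g <- as_].
have [|Fs Es] := @c_qsum (fun j => op (nth (qzero k) gs j) (nth (qzero k) as_ j)) (size gs).
  by move=> j lt_j; apply: op_fin; [case: (Jgs j lt_j) | apply: Fa; rewrite sz_as].
move/c0: Ia; rewrite cD ?cN ?rK //; last exact: fin_suppN.
move=> /(_ (fin_suppD (r_fin x) (fin_suppN Fs)))/eqP; rewrite subr_eq0 Es => /eqP ->.
apply: eq_bigr => j _; rewrite !(nth_map (qzero k)) ?sz_as // cM //.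
  by case: (Jgs j (ltn_ord j)).
by apply: Fa; rewrite sz_as.
Qed.

End NoetherianTransfer.

(** * The generic representation *)

(** Upward the sequence iterates [F]; downward it iterates the sections [G] of [F]. *)
Lemma int_seq_exists (T : Type) (F G : int -> T -> T) (s0 : T) :
  (forall a x, F a (G a x) = x) ->
  exists s : int -> T, s 0 = s0 /\ forall a, s (a + 1) = F a (s a).
Proof.
move=> FG.
pose up := fix up m := if m is m'.+1 then F (Posz m') (up m') else s0.
pose down := fix down m := G (Negz m) (if m is m'.+1 then down m' else s0).
exists (fun a => match a with Posz m => up m | Negz m => down m end); split=> // -[m|[|m]].
- by rewrite -PoszD addn1.
- by rewrite (_ : Negz 0 + 1 = 0) //= FG.
by rewrite (_ : Negz m.+1 + 1 = Negz m) ?[down m.+1]/= ?FG //; lia.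
Qed.

Section Substitution.
Variable k : fieldType.
Local Notation K := {poly {poly k}}.
Implicit Types (P Q x y : K).

Definition cst : k -> K := polyC \o polyC.
HB.instance Definition _ := GRing.RMorphism.on cst.

(** The outer variable ['X] goes to [x] and the inner variable ['X%:P] to [y]. *)
Definition subst x y : K -> K := horner_eval x \o map_poly (horner_eval y \o map_poly cst).
HB.instance Definition _ x y := GRing.RMorphism.on (subst x y).

Lemma substC x y c : subst x y (cst c) = cst c.
Proof. by rewrite /subst /cst /= map_polyC /= map_polyC /horner_eval !hornerC. Qed.

Lemma substX x y : subst x y 'X = x.
Proof. by rewrite /subst /= map_polyX /horner_eval hornerX. Qed.

Lemma substY x y : subst x y 'X%:P = y.
Proof. by rewrite /subst /= map_polyC /= map_polyX /horner_eval hornerC hornerX. Qed.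

Lemma rmorph_K_ext (f g : {rmorphism K -> K}) : (forall c, f (cst c) = g (cst c)) ->
  f 'X = g 'X -> f 'X%:P = g 'X%:P -> f =1 g.
Proof.
move=> fgC fgX fgY P; elim/poly_ind: P => [|P c IH]; first by rewrite !rmorph0.
rewrite !rmorphD !rmorphM /= IH fgX; congr (_ + _).
elim/poly_ind: c => [|c d IHc]; first by rewrite !rmorph0.
by rewrite polyCD polyCM !rmorphD !rmorphM /= IHc fgY fgC.
Qed.

Lemma subst_comp x y x1 y1 P :
  subst x y (subst x1 y1 P) = subst (subst x y x1) (subst x y y1) P.
Proof.
apply: (rmorph_K_ext (f := subst x y \o subst x1 y1) (g := subst (subst x y x1) (subst x y y1))).
- by move=> c; rewrite /= !substC.
- by rewrite /= !substX.
by rewrite /= !substY.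
Qed.

Lemma subst_id P : subst 'X 'X%:P P = P.
Proof.
by apply: (rmorph_K_ext (f := subst 'X 'X%:P) (g := idfun)) => [c||];
  rewrite /= ?substC ?substX ?substY.
Qed.

Variables al be ga : int -> k.
Hypothesis be_neq0 : forall a, be a != 0.

(* Passing from (lam (a + 1), lam a) to (lam (a + 2), lam (a + 1)) is an affine
   automorphism of the plane, which preserves algebraic independence. *)
Lemma generic_weights : exists lam : int -> K,
  (forall a, lam a = cst (al a) * lam (a + 1) + cst (be a) * lam (a + 1 + 1) + cst (ga a)) /\
  (forall a P, subst (lam (a + 1)) (lam a) P = 0 -> P = 0).
Proof.
(* The pair [s a] will be [(lam (a + 1), lam a)]: [F a] solves the recurrence for [lam (a + 2)], and
   [G a] goes back. *)
pose F a (t : K * K) := (cst (be a)^-1 * (t.2 - cst (al a) * t.1 - cst (ga a)), t.1).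
pose G a (t : K * K) := (t.2, cst (al a) * t.2 + cst (be a) * t.1 + cst (ga a)).
have bK a : cst (be a)^-1 * cst (be a) = 1.
  by rewrite -rmorphM mulVf ?be_neq0 // rmorph1.
have FG a t : F a (G a t) = t.
  case: t => x y; rewrite /F /G /=; congr pair.
  have -> (u v z : K) : u + v + z - u - z = v by ring.
  by rewrite mulrA bK mul1r.
have GF a t : G a (F a t) = t.
  case: t => x y; rewrite /F /G /=; congr pair.
  by rewrite mulrA [cst _ * cst _^-1]mulrC bK mul1r addrC addrCA; ring.
have [s [s0 sS]] := int_seq_exists ('X, 'X%:P) FG.
have s1 a : (s a).1 = (s (a + 1)).2 by rewrite sS.
exists (fun a => (s a).2); split=> [a|a P].
  by rewrite -[in RHS]s1 -s1 sS /F /= mulrA [cst (be _) * _]mulrC bK mul1r; ring.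
rewrite -s1; pose inj b := forall P, subst (s b).1 (s b).2 P = 0 -> P = 0.
move: P; rewrite -/(inj a).
(* [sg b] and [ta b] are inverse automorphisms of the polynomial ring; they carry independence up
   and down from the initial pair of variables. *)
pose sg b := subst (F b ('X, 'X%:P)).1 (F b ('X, 'X%:P)).2.
pose ta b := subst (G b ('X, 'X%:P)).1 (G b ('X, 'X%:P)).2.
have sub_F b t P : subst t.1 t.2 (sg b P) = subst (F b t).1 (F b t).2 P.
  by rewrite subst_comp /F /= !(rmorphM, rmorphB) /= !substC substX substY.
have sub_G b t P : subst t.1 t.2 (ta b P) = subst (G b t).1 (G b t).2 P.
  by rewrite subst_comp /G /= !(rmorphM, rmorphD) /= !substC substX substY.
have sgta b P : ta b (sg b P) = P by rewrite /ta sub_F FG subst_id.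
have tasg b P : sg b (ta b P) = P by rewrite /sg sub_G GF subst_id.
have up b : inj b -> inj (b + 1).
  move=> injb P; rewrite sS -sub_F => /injb E; rewrite -(sgta b P) E; exact: rmorph0.
have down b : inj (b + 1) -> inj b.
  move=> injb P; have -> : s b = G b (s (b + 1)) by rewrite sS GF.
  by rewrite -sub_G => /injb E; rewrite -(tasg b P) E; exact: rmorph0.
elim/int_ind: a => [P|m|m]; [by rewrite s0 subst_id | |].
- by rewrite -addn1 PoszD; apply: up.
by move=> H; apply: down; rewrite intS opprD addrAC addNr add0r.
Qed.

(** The polynomial ring receiving the weights is hidden behind a domain [R], so that only the
    evaluations [sb] and their values remain visible. *)
Lemma generic_model : exists (R : idomainType) (phi : {rmorphism k -> R}) (lam : int -> R)
    (sb : int -> {rmorphism K -> R}),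
  [/\ forall a c, sb a (cst c) = phi c, forall a, sb a 'X = lam (a + 1),
      forall a, sb a 'X%:P = lam a, forall a P, sb a P = 0 -> P = 0
    & forall a, lam a = phi (al a) * lam (a + 1) + phi (be a) * lam (a + 1 + 1) + phi (ga a)].
Proof.
have [lam [lamE lamI]] := generic_weights.
exists K, cst, lam, (fun a => subst (lam (a + 1)) (lam a)); split=> // a.
- by move=> c; exact: substC.
- exact: substX.
- exact: substY.
Qed.

End Substitution.

Section EvalXY.
Variables (k : fieldType) (n0 : nat) (A : algType k) (e : int -> A) (U D : A).
Variables (al be ga : int -> k).
Hypothesis DU : down_up n0 e U D al be ga.
Local Notation X := (U * D).
Local Notation Y := (D * U).

Lemma X_comm_alg : commr_rmorph (horner_alg Y) X.
Proof.
move=> p; elim/poly_ind: p => [|p c IH]; first by rewrite rmorph0; apply: commr0.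
rewrite rmorphD rmorphM /= horner_algX horner_algC; apply: commrD.
  by apply: commrM => //; apply: XY_comm DU.
by rewrite /GRing.comm -scalerAl -scalerAr mul1r mulr1.
Qed.

(** The outer variable goes to [U D] and the inner one to [D U]; their commutation makes this a ring
    morphism. *)
Definition evalXY : {poly {poly k}} -> A := horner_morph X_comm_alg.
HB.instance Definition _ := GRing.RMorphism.on evalXY.

Lemma evalXYB (P Q : {poly {poly k}}) : evalXY (P - Q) = evalXY P - evalXY Q.
Proof. by rewrite /evalXY rmorphB. Qed.

Definition bimon c p q : {poly {poly k}} := (c%:P * 'X^q)%:P * 'X^p.

Lemma evalXY_mon c p q : evalXY (bimon c p q) = c *: mon U D p q.
Proof.
rewrite /evalXY /bimon rmorphM rmorphXn /= horner_morphX horner_morphC rmorphM rmorphXn /=.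
rewrite horner_algC horner_algX monE -!scalerAl mul1r; congr (_ *: _).
by apply/commrX/commr_sym/commrX; rewrite /GRing.comm (XY_comm DU).
Qed.

End EvalXY.

(** * Leading terms in the generic representation *)

Section GenericAction.
Variables (k : fieldType) (n0 : nat).
Local Notation n := n0.+1.
Variables alpha beta gamma : 'I_n -> k.
Hypothesis beta_neq0 : forall i, beta i != 0.
Local Notation H := (halg alpha beta gamma).
Local Notation cls := (cls alpha beta gamma).
Local Notation e := (he alpha beta gamma).
Local Notation U := (hU alpha beta gamma).
Local Notation D := (hD alpha beta gamma).
Local Notation DU := (halg_down_up alpha beta gamma).
Local Notation ev := (evalXY DU).

Variables (K : idomainType) (phi : {rmorphism k -> K}) (lam : int -> K).
Variable sb : int -> {rmorphism {poly {poly k}} -> K}.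
Hypothesis sbC : forall a c, sb a (cst c) = phi c.
Hypothesis sbX : forall a, sb a 'X = lam (a + 1).
Hypothesis sbY : forall a, sb a 'X%:P = lam a.
Hypothesis sb_inj : forall a P, sb a P = 0 -> P = 0.
Hypothesis lamE : forall a, lam a = phi (at_vtx alpha a) * lam (a + 1)
  + phi (at_vtx beta a) * lam (a + 1 + 1) + phi (at_vtx gamma a).

Let mu (_ : int) : K := 1.
(** A step down from [a] has weight [nu (a - 1)]; the shift makes [D] act at [a] with coefficient
    [lam a]. *)
Let nu (a : int) : K := lam (a + 1).

Let defect0 a : weight_defect phi mu nu alpha beta gamma a = 0.
Proof.
rewrite /weight_defect /mu /nu subrK !mul1r [lam a]lamE; ring.
Qed.

Let mu_defect a : mu a * weight_defect phi mu nu alpha beta gamma a = 0.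
Proof. by rewrite defect0 mulr0. Qed.
Let nu_defect a : nu a * weight_defect phi mu nu alpha beta gamma a = 0.
Proof. by rewrite defect0 mulr0. Qed.

Local Notation T := (hact (alpha := alpha) (beta := beta) (gamma := gamma) phi mu nu).
Implicit Types (x y h g : H) (psi : int -> K) (a b d : int).

Let TM := hactM mu_defect nu_defect.
Let TD := hactD mu_defect nu_defect.
Let TZ := hactZ mu_defect nu_defect.
Let Te := hact_e mu_defect nu_defect.
Let TU := hact_U mu_defect nu_defect.
Let TDn := hact_D mu_defect nu_defect.

Lemma lam_neq0 a : lam a != 0.
Proof.
apply/eqP => lam0; have := @sb_inj a 'X%:P; rewrite sbY => /(_ lam0)/eqP.
by rewrite polyC_eq0 polyX_eq0.
Qed.

Lemma T_ev P psi a : T (ev P) psi a = sb a P * psi a.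
Proof.
elim/poly_ind: P psi => [|P c IH] psi.
  by rewrite !rmorph0 mul0r; apply: (hact0 mu_defect nu_defect).
rewrite !rmorphD !rmorphM TD TM IH /= mulrDl; congr (_ + _).
  rewrite /evalXY horner_morphX (hact_X mu_defect nu_defect) sbX.
  by rewrite /mu /nu mul1r mulrA.
rewrite /evalXY horner_morphC; elim/poly_ind: c psi => [|c d IHc] psi.
  by rewrite !rmorph0 mul0r; apply: (hact0 mu_defect nu_defect).
rewrite polyCD polyCM !rmorphD !rmorphM TD TM IHc /= mulrDl; congr (_ + _).
  rewrite horner_algX (hact_Y mu_defect nu_defect) sbY.
  by rewrite /mu /nu mul1r subrK mulrA.
rewrite horner_algC sbC TZ; congr (_ * _).
by rewrite -(hact_eM mu_defect nu_defect) mulr1 Te eqxx mul1r.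
Qed.

Lemma evalXY_inj i P : e i * ev P = 0 -> P = 0.
Proof.
move=> E; apply: (@sb_inj i); have := T_ev P (fun=> 1) i.
by rewrite -(hact_eM mu_defect nu_defect) E (hact0 mu_defect nu_defect) mulr1.
Qed.

Definition zpow d : H := match d with Posz m => U ^+ m | Negz m => D ^+ m.+1 end.

Lemma T_1 psi a : T 1 psi a = psi a.
Proof. by rewrite -(hact_eM mu_defect nu_defect) mulr1 Te eqxx mul1r. Qed.

Lemma T_zpow d a : exists2 c : K, c != 0 & forall psi, T (zpow d) psi a = c * psi (a + d).
Proof.
have TDm m b : exists2 c : K, c != 0 & forall psi, T (D ^+ m) psi b = c * psi (b - m%:Z).
  elim: m b => [|m IH] b; first by exists 1; rewrite ?oner_neq0 // => psi; rewrite T_1 mul1r subr0.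
  have [c c0 Ec] := IH (b - 1); exists (lam b * c); first by rewrite mulf_neq0 ?lam_neq0.
  by move=> psi; rewrite exprS TM TDn Ec /nu subrK mulrA intS opprD addrA.
case: d => m; last by have [c c0 Ec] := TDm m.+1 a; exists c => // psi; rewrite Ec NegzE.
exists 1; rewrite ?oner_neq0 // => psi; rewrite mul1r /=.
elim: m a => [|m IH] a; first by rewrite T_1 addr0.
by rewrite exprS TM TU IH /mu mul1r intS addrA.
Qed.

(** The window consists of the [N] consecutive degrees ending at [M], and [N] serves as the
    induction measure. *)
Definition window_gen (i M : int) (N : nat) g :=
  exists d p q, (M - N%:Z < d <= M)%R /\ g = e i * mon U D p q * zpow d.

(** The top degree read off from the action alone: on a function vanishing below [a + m], terms of
    degree less than [m] contribute nothing at [a]. *)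
Definition lead_deg i h m := exists c : int -> K, forall a, vtx n0 a = vtx n0 i ->
  c a != 0 /\ forall psi, (forall b, (b < a + m)%R -> psi b = 0) -> T h psi a = c a * psi (a + m).

Lemma window_split i M N h : lspan (window_gen i M N.+1) h ->
  exists P : {poly {poly k}}, lspan (window_gen i (M - 1) N) (h - e i * ev P * zpow M).
Proof.
elim=> [|c _ y [d [p [q [/andP[lt_d le_d] ->]]]] _ [P LP]].
  by exists 0; rewrite rmorph0 mulr0 mul0r subr0; apply: lspan0.
have [dM|ne_d] := eqVneq d M.
  exists (bimon c p q + P).
  rewrite rmorphD /= evalXY_mon mulrDr mulrDl -scalerAr -scalerAl dM opprD addrACA subrr add0r.
  exact: LP.
exists P; rewrite -addrA; apply: lspanD => //; apply/lspanZ/lspan_gen.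
by exists d, p, q; split=> //; move: lt_d le_d ne_d => /=; lia.
Qed.

Lemma T_window0 i M N h psi a : lspan (window_gen i M N) h ->
  (forall b, (b <= a + M)%R -> psi b = 0) -> T h psi a = 0.
Proof.
move=> + psi0; elim=> [|c _ y [d [p [q [/andP[_ le_d] ->]]]] _ IH].
  exact: (hact0 mu_defect nu_defect).
rewrite TD IH addr0 TZ TM [X in _ * X](_ : _ = 0) ?mulr0 //.
have [E0|ne_d] := eqVneq (vtx n0 a) (vtx n0 i); last first.
  by rewrite TM Te (negbTE ne_d) mul0r.
rewrite TM Te E0 eqxx mul1r.
have := T_ev (bimon 1 p q) (T (zpow d) psi) a; rewrite evalXY_mon scale1r => ->.
by have [c' _ ->] := T_zpow d a; rewrite psi0 ?mulr0 //; lia.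
Qed.

(** If the polynomial in the top degree vanishes, the window shrinks. Otherwise injectivity of
    [sb a] makes its value nonzero at every index. *)
Lemma lead_degP i M N h : lspan (window_gen i M N) h -> h = 0 \/ exists m, lead_deg i h m.
Proof.
elim: N M h => [|N IH] M h L.
  by left; elim: L => // c g y [d [p [q [/andP[lt_d le_d] _]]]]; move: lt_d le_d => /=; lia.
have [P LP] := window_split L; have [P0|P_neq0] := eqVneq P 0.
  by apply: (IH (M - 1)); move: LP; rewrite P0 rmorph0 mulr0 mul0r subr0.
right; exists M.
have /choice[c Pc] : forall a, exists c : K, c != 0 /\ forall psi, T (zpow M) psi a = c * psi (a + M).
  by move=> a; have [c c0 Ec] := T_zpow M a; exists c.
exists (fun a => sb a P * c a) => a Ea.
have [c0 Ec] := Pc a; split.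
  by rewrite mulf_neq0 //; apply: contra_neq P_neq0; apply: sb_inj.
move=> psi psi0; rewrite -(subrK (e i * ev P * zpow M) h) TD (T_window0 LP) ?add0r.
  by rewrite TM TM Te Ea eqxx mul1r T_ev Ec mulrA.
by move=> b le_b; apply: psi0; move: le_b; lia.
Qed.

Lemma window_exists i x : exists M N, lspan (window_gen i M N) (e i * x).
Proof.
suff [B LB] : exists B : nat, lspan (fun g => exists d p q, (- B%:Z <= d <= B%:Z)%R /\
    g = e i * mon U D p q * zpow d) (e i * x).
  (* The degrees from [-B] to [B] form a window of [2B + 1] degrees ending at [B]. *)
  exists B, (B + B).+1; move: LB; apply: lspan_sub => _ [d [p [q [le_d ->]]]].
  by apply: lspan_gen; exists d, p, q; split=> //; lia.
have mono B B' y : (B <= B')%N ->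
   lspan (fun g => exists d p q, (- B%:Z <= d <= B%:Z)%R /\ g = e i * mon U D p q * zpow d) y ->
   lspan (fun g => exists d p q, (- B'%:Z <= d <= B'%:Z)%R /\ g = e i * mon U D p q * zpow d) y.
  move=> le_B; apply: lspan_sub => _ [d [p [q [le_d ->]]]].
  by apply: lspan_gen; exists d, p, q; split=> //; lia.
suff gen j g : stage_gen e U D U (neg_gen e U D) j g ->
    exists B : nat, lspan (fun g => exists d p q, (- B%:Z <= d <= B%:Z)%R /\
    g = e i * mon U D p q * zpow d) (e i * g).
  have be0 a : at_vtx beta a != 0 by apply: beta_neq0.
  rewrite [x](e_decomp DU) mulr_sumr; elim/big_ind: _ => [|y z [B LB] [B' LB']|j _].
  - by exists 0%N; apply: lspan0.
  - exists (maxn B B'); apply: lspanD; [apply: mono LB | apply: mono LB'];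
    by rewrite ?leq_maxl ?leq_maxr.
  elim: (normal_form DU be0 x (j : nat)) => [|c g y /gen[B LB] _ [B' LB']].
    by exists 0%N; rewrite mulr0; apply: lspan0.
  exists (maxn B B'); rewrite mulrDr -scalerAr; apply: lspanD; last first.
    by apply: mono LB'; rewrite leq_maxr.
  by apply/lspanZ; apply: mono LB; rewrite leq_maxl.
have red (Z : H) b j' m p q : e b * Z ^+ m = Z ^+ m * e j' ->
    e i * (mon U D p q * Z ^+ m * e j') = 0 \/
    e i * (mon U D p q * Z ^+ m * e j') = e i * mon U D p q * Z ^+ m.
  move=> Eb; rewrite -[mon _ _ _ _ * _ * _]mulrA -Eb [mon _ _ _ _ * _]mulrA.
  rewrite -(e_inR DU _ (inR_mon _ _ _ _)) !mulrA (du_ee DU).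
  by case: ifP => _; [right | left; rewrite !mul0r].
have eDD b : e b * D = D * e (b + -1) by rewrite (du_De DU) subrK.
case=> [[m [p [q ->]]]|[[[m p] q] ->]].
  have Eb : e (j + 1 * m.+1%:Z) * D ^+ m.+1 = D ^+ m.+1 * e j.
    by rewrite (e_Zexp eDD) mul1r mulN1r addrK.
  exists m.+1; case: (red _ _ _ _ p q Eb) => ->; first exact: lspan0.
  by apply: lspan_gen; exists (Negz m), p, q; split=> //; lia.
have Eb : e (j - 1 * m%:Z) * U ^+ m = U ^+ m * e j by rewrite (e_Zexp (du_eU DU)) subrK.
exists m; rewrite /zmon /=; case: (red _ _ _ _ p q Eb) => ->; first exact: lspan0.
by apply: lspan_gen; exists (Posz m), p, q; split=> //; lia.
Qed.

Lemma lead_deg_exists i x : e i * x = 0 \/ exists m, lead_deg i (e i * x) m.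
Proof. by have [M [N L]] := window_exists i x; apply: lead_degP L. Qed.

Lemma halg_piecewise_domain i l j x y :
  (e i * x * e l) * (e l * y * e j) = 0 -> e i * x * e l = 0 \/ e l * y * e j = 0.
Proof.
move=> E; case: (lead_deg_exists i (x * e l)) => [|[m [c Pc]]]; first by rewrite mulrA; left.
case: (lead_deg_exists l (y * e j)) => [|[m' [c' Pc']]]; first by rewrite mulrA; right.
exfalso; have [ci0 Ec] := Pc i erefl.
(* Otherwise [e l] would kill the indicator of [i + m], on which the leading term is nonzero. *)
have vl : vtx n0 (i + m) = vtx n0 l.
  apply/eqP; apply: contraT => ne_l.
  have := Ec (fun b => (b == i + m)%:R); rewrite eqxx mulr1 => /(_ _)/esym Ei.
  move/eqP: ci0; case; rewrite Ei => [|b lt_b]; last by rewrite lt_eqF.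
  rewrite mulrA TM [X in T _ X](_ : _ = fun=> 0).
    exact: hact_vec0.
  apply/funext => b; rewrite Te; case: (b =P i + m) => [->|]; last by rewrite mulr0.
  by rewrite (negbTE ne_l) mul0r.
have [cl0 Ec'] := Pc' _ vl.
(* On this indicator only the product of the two leading terms is seen at [i]. *)
pose psi b : K := (b == i + m + m')%:R.
have psi0 b : (b < i + m + m')%R -> psi b = 0 by move=> lt_b; rewrite /psi lt_eqF.
have := hact0 mu_defect nu_defect psi i; rewrite -E TM -mulrA Ec => [|b lt_b].
  rewrite -mulrA Ec' // /psi eqxx mulr1 => /eqP; rewrite mulf_eq0.
  by rewrite (negbTE ci0) (negbTE cl0).
have [vb|ne_b] := eqVneq (vtx n0 b) (vtx n0 l).
  have [_ Ecb] := Pc' _ vb; rewrite -mulrA Ecb => [|b' lt_b']; rewrite psi0 ?mulr0 //.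
    by move: lt_b; lia.
  by move: lt_b lt_b'; lia.
by rewrite -mulrA TM Te (negbTE ne_b) mul0r.
Qed.

End GenericAction.

Section PolyEval.
Variables (k : fieldType) (n0 : nat).
Local Notation n := n0.+1.
Variables alpha beta gamma : 'I_n -> k.
Local Notation H := (halg alpha beta gamma).
Local Notation cls := (cls alpha beta gamma).
Local Notation e := (he alpha beta gamma).
Local Notation U := (hU alpha beta gamma).
Local Notation D := (hD alpha beta gamma).
Local Notation DU := (halg_down_up alpha beta gamma).

Lemma bimon_sum (P : {poly {poly k}}) :
  P = \sum_(a < size P) \sum_(b < size P`_a) bimon P`_a`_b a b.
Proof.
rewrite -{1}[P]coefK poly_def; apply: eq_bigr => a _.
rewrite -{1}[P`_a]coefK poly_def scaler_suml; apply: eq_bigr => b _.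
by rewrite /bimon -!mul_polyC.
Qed.

Definition qX i : qfun k := qmul n (qu k i) (qd k n i).
Definition qY i : qfun k := qmul n (qd k n (vdown n i)) (qu k (vdown n i)).

Lemma fin_qX a : fin_supp n (qX (vtx n0 a)).
Proof. by apply: fin_suppM; [apply: fin_supp_qu | apply: fin_supp_qd]. Qed.

Lemma fin_qY a : fin_supp n (qY (vtx n0 a)).
Proof. by rewrite /qY vdown_vtx; apply: fin_suppM; [apply: fin_supp_qd | apply: fin_supp_qu]. Qed.

Lemma cls_qX a : cls (qX (vtx n0 a)) = e a * (U * D).
Proof.
rewrite /qX clsM; [|exact: fin_supp_qu|exact: fin_supp_qd].
by rewrite cls_qu_r cls_qd_l -mulrA [e _ * (_ * _)]mulrA he_mul eqxx mulrA -he_U mulrA.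
Qed.

Lemma cls_qY a : cls (qY (vtx n0 a)) = e a * (D * U).
Proof.
rewrite /qY vdown_vtx clsM; [|exact: fin_supp_qd|exact: fin_supp_qu].
by rewrite cls_qd_r cls_qu_l -mulrA [e _ * (_ * _)]mulrA he_mul eqxx mulrA hD_e subrK mulrA.
Qed.

Lemma fin_qpow a (x : qfun k) m : fin_supp n x -> fin_supp n (qpow n (vtx n0 a) x m).
Proof.
by move=> Fx; elim: m => [|m IH]; [apply: fin_supp_qe | apply: fin_suppM].
Qed.

Lemma he_mulC a (z z' : H) : e a * z = z * e a -> e a * z * (e a * z') = e a * (z * z').
Proof. by move=> ez; rewrite ez -mulrA [e a * (e a * _)]mulrA he_mul eqxx mulrA -ez mulrA. Qed.

Lemma cls_qpow a x (z : H) m : fin_supp n x -> cls x = e a * z -> e a * z = z * e a ->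
  cls (qpow n (vtx n0 a) x m) = e a * z ^+ m.
Proof.
move=> Fx cx ez; elim: m => [|m IH]; first by rewrite mulr1.
rewrite /= clsM //; last exact: fin_qpow.
have ezm : e a * z ^+ m = z ^+ m * e a by apply: commrX.
by rewrite -/(qpow _ _ _ _) IH cx ezm -mulrA [e a * _]mulrA he_mul eqxx mulrA -ezm -mulrA exprSr.
Qed.

(** The powers in [poly2_eval] begin with the idempotent at the vertex, so each term carries that
    idempotent, which factors out. *)
Lemma cls_poly2_eval a (P : {poly {poly k}}) :
  let f := poly2_eval n (vtx n0 a) (qX (vtx n0 a)) (qY (vtx n0 a)) P in
  fin_supp n f /\ cls f = e a * evalXY DU P.
Proof.
have Fm p q : fin_supp n (qmul n (qpow n (vtx n0 a) (qX (vtx n0 a)) p) (qpow n (vtx n0 a) (qY (vtx n0 a)) q)).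
  by apply: fin_suppM; apply: fin_qpow; [apply: fin_qX | apply: fin_qY].
have cD := @clsD _ _ alpha beta gamma.
have inner p := @c_qsum _ n0 _ cls cD (fun q => qscale P`_p`_q
  (qmul n (qpow n (vtx n0 a) (qX (vtx n0 a)) p) (qpow n (vtx n0 a) (qY (vtx n0 a)) q))) (size P`_p)
  (fun q _ => fin_suppZ _ (Fm p q)).
have := @c_qsum _ n0 _ cls cD (fun p => qsum [seq qscale P`_p`_q
  (qmul n (qpow n (vtx n0 a) (qX (vtx n0 a)) p) (qpow n (vtx n0 a) (qY (vtx n0 a)) q))
   | q <- iota 0 (size P`_p)]) (size P) (fun p _ => (inner p).1).
case=> F E; split; first exact: F.
rewrite -[cls _]/(cls (qsum _)) E [in RHS](bimon_sum P) rmorph_sum mulr_sumr.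
apply: eq_bigr => p _; rewrite (inner p).2 rmorph_sum mulr_sumr; apply: eq_bigr => q _.
rewrite clsZ // clsM; [|by apply: fin_qpow; apply: fin_qX|by apply: fin_qpow; apply: fin_qY].
rewrite (cls_qpow _ (fin_qX a) (cls_qX a) (e_X DU a)).
rewrite (cls_qpow _ (fin_qY a) (cls_qY a) (e_Y DU a)).
rewrite /= evalXY_mon monE -scalerAr; congr (_ *: _).
have eX : e a * (U * D) ^+ p = (U * D) ^+ p * e a by apply/commrX/(e_X DU).
exact: he_mulC.
Qed.

Lemma qXY_comm a : inI alpha beta gamma
  (qadd (qmul n (qX (vtx n0 a)) (qY (vtx n0 a))) (qopp (qmul n (qY (vtx n0 a)) (qX (vtx n0 a))))).
Proof.
have [FX FY] := (fin_qX a, fin_qY a).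
apply/clsP; [exact: fin_suppM | exact: fin_suppM |].
rewrite (clsM _ _ _ FX FY) (clsM _ _ _ FY FX) cls_qX cls_qY.
by rewrite (he_mulC _ (e_X DU a)) (he_mulC _ (e_Y DU a)) (XY_comm DU).
Qed.

End PolyEval.

Section Nonvanishing.
Variables (k : fieldType) (n0 : nat).
Local Notation n := n0.+1.
Variables alpha beta gamma : 'I_n -> k.
Hypothesis beta_neq0 : forall i, beta i != 0.

Lemma poly_ring2_of_beta (i : 'I_n) : is_poly_ring2 alpha beta gamma i (qX k n0 i) (qY k n0 i).
Proof.
have be0 a : at_vtx beta a != 0 by apply: beta_neq0.
have [R [phi [lam [sb [sbC sbX sbY sbI lamE]]]]] := generic_model (at_vtx alpha) (at_vtx gamma) be0.
rewrite -(vtx_nat (ltn_ord i)); split; first exact: qXY_comm.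
move=> P /eqP P0 I; apply: P0; have [F E] := cls_poly2_eval alpha beta gamma (i : nat) P.
move/(cls_eq0 alpha beta gamma F): I; rewrite E.
exact: (evalXY_inj sbC sbX sbY sbI lamE).
Qed.

Lemma piecewise_domain_of_beta : H_piecewise_domain alpha beta gamma.
Proof.
have be0 a : at_vtx beta a != 0 by apply: beta_neq0.
have [R [phi [lam [sb [sbC sbX sbY sbI lamE]]]]] := generic_model (at_vtx alpha) (at_vtx gamma) be0.
move=> i l j a b Fa Fb /=.
have Fe (v : 'I_n) : fin_supp n (qe k v) by apply: fin_supp_qbasis.
have F1 := fin_suppM (Fe i) (fin_suppM Fa (Fe l)).
have F2 := fin_suppM (Fe l) (fin_suppM Fb (Fe j)).
rewrite -!(cls_eq0 alpha beta gamma) //; last exact: fin_suppM.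
have ce (v : 'I_n) : cls alpha beta gamma (qe k v) = he alpha beta gamma (v : nat).
  by rewrite /he vtx_nat.
have Fae := fin_suppM Fa (Fe l); have Fbe := fin_suppM Fb (Fe j).
rewrite !clsM // !ce => E.
have := halg_piecewise_domain beta_neq0 sbC sbX sbY sbI lamE (i := i : nat) (l := l : nat)
  (j := j : nat) (x := cls alpha beta gamma a) (y := cls alpha beta gamma b).
rewrite -!mulrA; apply; move: E; by rewrite -!mulrA.
Qed.

End Nonvanishing.

(** * The case where some beta vanishes *)

Section Opposite.
Variables (k : fieldType) (A : algType k).

HB.instance Definition _ := GRing.Zmodule_isLmodule.Build k A^c
  (@scalerA k A) (@scale1r k A) (@scalerDr k A) (@scalerDl k A).

Lemma converse_scalerAl (c : k) (x y : A^c) : c *: (x * y) = (c *: x) * y.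
Proof. exact: (scalerAr c (y : A) (x : A)). Qed.
HB.instance Definition _ := GRing.Lmodule_isLalgebra.Build k A^c converse_scalerAl.

Lemma converse_scalerAr (c : k) (x y : A^c) : c *: (x * y) = x * (c *: y).
Proof. exact: (scalerAl c (y : A) (x : A)). Qed.
HB.instance Definition _ := GRing.Lalgebra_isAlgebra.Build k A^c converse_scalerAr.

Lemma converse_down_up (n0 : nat) (e : int -> A) (U D : A) (al be ga : int -> k) :
  down_up n0 e U D al be ga -> down_up n0 (e : int -> A^c) (D : A^c) (U : A^c) al be ga.
Proof.
case=> eE ee e1 eU De DUU DDU indl indr; split=> //.
- move=> a b; rewrite -[LHS]/((e b : A) * e a) ee eq_sym.
  by case: eqP => // /eE.
(* Reversal exchanges the two relations; the triple products are rebracketed to agree with the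
   opposite product by conversion. *)
- by move=> a; have E := DDU a; rewrite -(mulrA D D U) -(mulrA D U D) -(mulrA U D D) in E.
- by move=> a; have E := DUU a; rewrite -(mulrA D U U) -(mulrA U D U) -(mulrA U U D) in E.
- by move=> P PD PZ Pe PU PDn; apply: indr.
by move=> P PD PZ Pe PU PDn; apply: indl.
Qed.

End Opposite.

Section NotNoetherian.

(** In the ideal generated by all [w m], finitely many generators already lie in the part generated
    by the first [N], which misses [w N]. *)
Lemma chain_not_noetherian (A : nzRingType) (w : nat -> A) :
  (forall N, ~ right_span [seq w m | m <- iota 0 N] (w N)) -> ~ right_noetherian A.
Proof.
move=> wN NA; pose J x := exists N, right_span [seq w m | m <- iota 0 N] x.
have sub N N' : (N <= N')%N -> {subset [seq w m | m <- iota 0 N] <= [seq w m | m <- iota 0 N']}.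
  move=> le_N x /mapP[m]; rewrite mem_iota => /andP[_ lt_m] ->; apply: map_f.
  by rewrite mem_iota /= (leq_trans lt_m).
have JD x y : J x -> J y -> J (x + y).
  move=> [N Lx] [N' Ly]; exists (maxn N N').
  by apply: right_spanD; [move: Lx | move: Ly]; apply: right_span_sub; apply: sub;
     rewrite ?leq_maxl ?leq_maxr.
have JM x a : J x -> J (x * a).
  case=> N Lx; exists N; elim: Lx => [|g b y Gg _ IH]; first by rewrite mul0r; apply: right_span0.
  by rewrite mulrDl -mulrA; apply: right_spanS.
have [|gs [Jgs Egs]] := NA J _ JD JM; first by exists 0%N; apply: right_span0.
have [N LN] : exists N, forall j, (j < size gs)%N -> right_span [seq w m | m <- iota 0 N] gs`_j.
  elim: gs Jgs {Egs} => [|g gs IH] Jgs; first by exists 0%N.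
  have [N LN] := IH (fun j => Jgs j.+1); have [N' LN'] := Jgs 0%N isT.
  exists (maxn N N') => -[_|j lt_j].
    by move: LN'; apply: right_span_sub; apply: sub; rewrite leq_maxr.
  by move: (LN j lt_j); apply: right_span_sub; apply: sub; rewrite leq_maxl.
have [|as_ E] := Egs (w N).
  exists N.+1; rewrite -[w N]mulr1; apply: right_span_gen; apply: map_f.
  by rewrite mem_iota /=.
apply: (wN N); rewrite E; elim/big_ind: _ => [|x y|j _]; [exact: right_span0 | exact: right_spanD |].
have := LN j (ltn_ord j); elim=> [|g b y Gg _ IH]; first by rewrite mul0r; apply: right_span0.
by rewrite mulrDl -mulrA; apply: right_spanS.
Qed.

End NotNoetherian.

Lemma truncated_weights (k : fieldType) (al be ga : int -> k) (i : int) :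
  exists lam : int -> k, [/\ lam i = 1 + ga i, forall a, (i < a)%R -> lam a = 0 &
    forall a, (a < i)%R -> lam a = al a * lam (a + 1) + be a * lam (a + 1 + 1) + ga a].
Proof.
(* [tw b] is the pair [(lam (i - b + 1), lam (i - b))]. The value [1 + ga i] will make the
   annihilator of [U] act by 1 at [i]. *)
pose tw := fix tw b : k * k := if b is b'.+1 then
   let a := i - b%:Z in ((tw b').2, al a * (tw b').2 + be a * (tw b').1 + ga a)
   else (0, 1 + ga i).
pose lam a := if (a <= i)%R then (tw `|i - a|%N).2 else 0.
have lamE b : lam (i - b%:Z) = (tw b).2.
  rewrite /lam ifT; last by lia.
  by rewrite (_ : `|_|%N = b) //; lia.
have lam1 b : lam (i - b%:Z + 1) = (tw b).1.
  case: b => [|b]; first by rewrite /lam ifF //; lia.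
  by rewrite (_ : i - b.+1%:Z + 1 = i - b%:Z) ?lamE //; lia.
exists lam; split=> [|a lt_a|a lt_a].
- by have := lamE 0%N; rewrite subr0.
- by rewrite /lam ifF //; lia.
have [b ->] : exists b : nat, a = i - b.+1%:Z by exists `|i - a|.-1%N; lia.
rewrite lamE [tw _]/= -lamE -lam1.
by rewrite (_ : i - b.+1%:Z + 1 = i - b%:Z) //; lia.
Qed.

(** * The truncated representation at a vertex with vanishing beta *)

Section TruncatedAction.
Variables (k : fieldType) (n0 : nat).
Local Notation n := n0.+1.
Variables alpha beta gamma : 'I_n -> k.
Local Notation H := (halg alpha beta gamma).
Local Notation e := (he alpha beta gamma).
Local Notation U := (hU alpha beta gamma).
Local Notation D := (hD alpha beta gamma).
Local Notation DU := (halg_down_up alpha beta gamma).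
Variable i : int.
Hypothesis be0 : at_vtx beta i = 0.

Definition annU : H := e i * (D * U - at_vtx alpha i *: (U * D) - (at_vtx gamma i)%:A).

(** Without its beta term, the relation at [i] has this form. *)
Lemma annU_U : annU * U = 0.
Proof.
rewrite /annU -mulrA !mulrBl mulrBr mulrBr (du_DUU DU) be0 scale0r addr0.
rewrite -!scalerAl mul1r -!scalerAr; rewrite addrAC addrK subrr. by [].
Qed.

Lemma annU_X : annU * (U * D) = 0.
Proof. by rewrite mulrA annU_U mul0r. Qed.

Lemma annU_e : annU * e i = annU.
Proof.
rewrite /annU; set z := (_ - _ : H).
have ez : z * e i = e i * z.
  by rewrite /z !mulrBl !mulrBr -!scalerAl -!scalerAr mul1r mulr1 (e_X DU) (e_Y DU).
by rewrite -mulrA ez mulrA he_mul eqxx.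
Qed.

Variable lam : int -> k.
Hypothesis lam_i : lam i = 1 + at_vtx gamma i.
Hypothesis lam_gt : forall a, (i < a)%R -> lam a = 0.
Hypothesis lam_rec : forall a, (a < i)%R -> lam a = at_vtx alpha a * lam (a + 1)
  + at_vtx beta a * lam (a + 1 + 1) + at_vtx gamma a.

(* With [up] the arrows of U act with coefficient 1 below the truncation index i,
   otherwise those of D do; both vanish from i on. *)
Variable up : bool.
Definition trunc_mu a : k := if (a < i)%R then (if up then 1 else lam (a + 1)) else 0.
Definition trunc_nu a : k := if (a < i)%R then (if up then lam (a + 1) else 1) else 0.

Lemma trunc_prod a : trunc_mu a * trunc_nu a = lam (a + 1).
Proof.
rewrite /trunc_mu /trunc_nu; case: ltP => [|le_i]; first by case: up; rewrite ?mul1r ?mulr1.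
by rewrite mul0r lam_gt //; lia.
Qed.

Lemma trunc_defect a : (a < i)%R ->
  weight_defect idfun trunc_mu trunc_nu alpha beta gamma a = 0.
Proof.
move=> lt_a; rewrite /weight_defect !trunc_prod subrK lam_rec // /at_vtx /=; ring.
Qed.

(** Below [i] the recurrence holds, and from [i] on the arrows act by zero; at [i] itself the defect
    is 1. *)
Lemma mu_defect a : trunc_mu a * weight_defect idfun trunc_mu trunc_nu alpha beta gamma a = 0.
Proof.
have [lt_a|le_a] := ltP a i; first by rewrite trunc_defect ?mulr0.
by rewrite /trunc_mu ltNge le_a mul0r.
Qed.
Lemma nu_defect a : trunc_nu a * weight_defect idfun trunc_mu trunc_nu alpha beta gamma a = 0.
Proof.
have [lt_a|le_a] := ltP a i; first by rewrite trunc_defect ?mulr0.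
by rewrite /trunc_nu ltNge le_a mul0r.
Qed.

Local Notation T := (hact (alpha := alpha) (beta := beta) (gamma := gamma) idfun trunc_mu trunc_nu).

Lemma T_annU psi a : T annU psi a =
  (vtx n0 a == vtx n0 i)%:R * ((lam a - at_vtx alpha i * lam (a + 1) - at_vtx gamma i) * psi a).
Proof.
rewrite /annU (hactM mu_defect nu_defect) (hact_e mu_defect nu_defect); congr (_ * _).
rewrite !(hactD mu_defect nu_defect) !(hactN mu_defect nu_defect).
rewrite (hact_Y mu_defect nu_defect) !(hactZ mu_defect nu_defect) (hact_X mu_defect nu_defect).
rewrite !trunc_prod subrK -(hact_eM mu_defect nu_defect 1) mulr1 (hact_e mu_defect nu_defect) eqxx.
by rewrite /= mul1r !mulrBl mulrA.
Qed.

(** Indices over the vertex of [i] also have vanishing beta, so the recurrence there is exactly the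
    vanishing of the factor in [T_annU]. *)
Lemma T_annU_lt psi a : (a < i)%R -> T annU psi a = 0.
Proof.
move=> lt_a; rewrite T_annU; case: eqP => [Ea|_]; last by rewrite mul0r.
have vE : vord n0 a = vord n0 i by apply: val_inj.
move: be0; rewrite lam_rec // /at_vtx vE => ->.
by rewrite mul0r addr0 addrAC addrK subrr mul0r mulr0.
Qed.

Lemma T_annU_i psi : T annU psi i = psi i.
Proof.
rewrite T_annU eqxx mul1r (@lam_gt (i + 1)); last by lia.
by rewrite lam_i mulr0 subr0 addrK mul1r.
Qed.

Lemma annU_neq0 : annU <> 0.
Proof.
move=> E; have := T_annU_i (fun=> 1); rewrite E (hact0 mu_defect nu_defect).
by move/esym/eqP; rewrite oner_eq0.
Qed.

Lemma T_expU m psi a : exists c, (up -> (a + m%:Z <= i)%R -> c = 1) /\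
  T (U ^+ m) psi a = c * psi (a + m%:Z).
Proof.
elim: m a => [|m IH] a.
  exists 1; split=> //.
  by rewrite -(hact_eM mu_defect nu_defect) mulr1 (hact_e mu_defect nu_defect) eqxx addr0.
have [c [c1 Ec]] := IH (a + 1); exists (trunc_mu a * c); split.
  move=> upT le_i; rewrite c1 ?mulr1 //; last by lia.
  by rewrite /trunc_mu upT ifT //; lia.
by rewrite exprS (hactM mu_defect nu_defect) (hact_U mu_defect nu_defect) Ec mulrA intS addrA.
Qed.

Lemma T_expD m psi a : exists c, (~~ up -> (a <= i)%R -> c = 1) /\
  T (D ^+ m) psi a = c * psi (a - m%:Z).
Proof.
elim: m a => [|m IH] a.
  exists 1; split=> //.
  by rewrite -(hact_eM mu_defect nu_defect) mulr1 (hact_e mu_defect nu_defect) eqxx subr0.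
have [c [c1 Ec]] := IH (a - 1); exists (trunc_nu (a - 1) * c); split.
  move=> /negbTE upF le_i; rewrite c1 ?mulr1 ?upF //; last by lia.
  by rewrite /trunc_nu upF ifT //; lia.
by rewrite exprS (hactM mu_defect nu_defect) (hact_D mu_defect nu_defect) Ec mulrA intS opprD addrA.
Qed.

(** Evaluated at [i - N], each [U^m annU b] with [m < N] reads [annU b] below [i], hence gives 0,
    whereas [U^N] reaches [i], where [annU] acts by 1. *)
Lemma trunc_not_right_noetherian : up -> ~ right_noetherian H.
Proof.
move=> upT; apply: (@chain_not_noetherian _ (fun m => U ^+ m * annU)) => N L.
have {L} : T (U ^+ N * annU) (fun=> 1) (i - N%:Z) = 0.
  elim: L => [|g b y /mapP[m]]; first exact: (hact0 mu_defect nu_defect).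
  rewrite mem_iota /= add0n => lt_m -> _ IH.
  rewrite (hactD mu_defect nu_defect) IH addr0 -mulrA (hactM mu_defect nu_defect).
  have [c [_ ->]] := T_expU m (T (annU * b) (fun=> 1)) (i - N%:Z).
  by rewrite (hactM mu_defect nu_defect) T_annU_lt ?mulr0 //; lia.
rewrite (hactM mu_defect nu_defect); have [c [c1 ->]] := T_expU N (T annU (fun=> 1)) (i - N%:Z).
rewrite subrK T_annU_i c1 ?mul1r // ?subrK //.
by move/eqP; rewrite oner_eq0.
Qed.

(** On the indicator of [i - N], [D^m] leaves a function supported at [i - N + m]. For [m < N] this
    lies below [i] and [annU] kills it; for [m = N] it does not. *)
Lemma trunc_not_left_noetherian : ~~ up -> ~ right_noetherian H^c.
Proof.
move=> upF; apply: (@chain_not_noetherian H^c (fun m => annU * D ^+ m)) => N L.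
pose psi b : k := (b == i - N%:Z)%:R.
have {L} : T (annU * D ^+ N) psi i = 0.
  elim: L => [|g b y /mapP[m]]; first exact: (hact0 mu_defect nu_defect).
  rewrite mem_iota /= add0n => lt_m -> _ IH.
  rewrite (hactD mu_defect nu_defect) IH addr0 -[_ * b]/((b : H) * (annU * D ^+ m)).
  rewrite (hactM mu_defect nu_defect) [T _ psi](_ : _ = fun=> 0) ?hact_vec0 //.
  apply/funext => a.
  rewrite (hactM mu_defect nu_defect).
  have [c [_ Ec]] := T_expD m psi a; have [aE|ne_a] := eqVneq (a - m%:Z) (i - N%:Z).
    by rewrite T_annU_lt //; lia.
  by rewrite T_annU Ec /psi (negbTE ne_a) !mulr0.
rewrite (hactM mu_defect nu_defect) T_annU_i; have [c [c1 ->]] := T_expD N psi i.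
rewrite c1 // /psi eqxx mul1r.
by move/eqP; rewrite oner_eq0.
Qed.

Lemma trunc_eU_neq0 : up -> e i * U <> 0.
Proof.
(* The index [i - n] lies over the same vertex as [i] but below the truncation, where [U] acts with
   coefficient 1. *)
move=> upT E; have := hact0 mu_defect nu_defect (fun=> 1) (i - n%:Z).
rewrite -E (hactM mu_defect nu_defect) (hact_e mu_defect nu_defect) (hact_U mu_defect nu_defect).
have -> : vtx n0 (i - n%:Z) = vtx n0 i.
  by apply/eqP; rewrite eq_vtx -(modzDr (i - n%:Z)) subrK.
rewrite eqxx /trunc_mu upT ifT ?mulr1; last by lia.
by move/eqP; rewrite oner_eq0.
Qed.

End TruncatedAction.

Lemma coef_bimon (k : fieldType) (c : k) p q p' q' :
  (bimon c p q)`_p'`_q' = c *+ ((p' == p) && (q' == q)).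
Proof.
rewrite /bimon coefCM coefXn mulr_natr; case: (p' == p); last by rewrite !mulr0n coef0.
by rewrite mulr1n coefCM coefXn mulr_natr.
Qed.

(** * The conditions compared with the vanishing of some beta *)

Section Equivalences.
Variables (k : fieldType) (n0 : nat).
Local Notation n := n0.+1.
Variables alpha beta gamma : 'I_n -> k.
Local Notation H := (halg alpha beta gamma).
Local Notation cls := (cls alpha beta gamma).
Local Notation DU := (halg_down_up alpha beta gamma).

Lemma H_right_noetherianP : H_right_noetherian alpha beta gamma <-> right_noetherian H.
Proof.
have := right_noetherian_transfer (@fin_suppM k n0) (@clsD k n0 alpha beta gamma)
  (@clsN k n0 alpha beta gamma) (@clsM k n0 alpha beta gamma) (@cls_eq0 k n0 alpha beta gamma)
  (@fin_hrep k n0 alpha beta gamma) (@hrepK k n0 alpha beta gamma).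
exact: iff_sym.
Qed.

Lemma H_left_noetherianP : H_left_noetherian alpha beta gamma <-> right_noetherian H^c.
Proof.
have := @right_noetherian_transfer k n0 (inI alpha beta gamma) (fun f g => qmul n g f) H^c
  cls (@hrep k n0 alpha beta gamma)
  (fun f g Ff Fg => fin_suppM Fg Ff) (@clsD k n0 alpha beta gamma)
  (@clsN k n0 alpha beta gamma) (fun f g Ff Fg => clsM alpha beta gamma Fg Ff)
  (@cls_eq0 k n0 alpha beta gamma)
  (@fin_hrep k n0 alpha beta gamma) (@hrepK k n0 alpha beta gamma).
exact: iff_sym.
Qed.

Lemma right_noetherian_of_beta : (forall i, beta i != 0) -> H_right_noetherian alpha beta gamma.
Proof.
by move=> b0; apply/H_right_noetherianP; apply: (down_up_right_noetherian DU) => a; apply: b0.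
Qed.

Lemma left_noetherian_of_beta : (forall i, beta i != 0) -> H_left_noetherian alpha beta gamma.
Proof.
move=> b0; apply/H_left_noetherianP.
by apply: (down_up_right_noetherian (converse_down_up DU)) => a; apply: b0.
Qed.

Section ZeroBeta.
Variable i : 'I_n.
Hypothesis beta_i : beta i = 0.

Let be_i : at_vtx beta i = 0. Proof. by rewrite /at_vtx vord_nat. Qed.
Let weights := truncated_weights (at_vtx alpha) (at_vtx beta) (at_vtx gamma) i.

Lemma not_right_noetherian : ~ H_right_noetherian alpha beta gamma.
Proof.
have [lam [lam_i lam_gt lam_rec]] := weights.
by move/H_right_noetherianP; apply: (trunc_not_right_noetherian be_i lam_i lam_gt lam_rec (up := true)).
Qed.

Lemma not_left_noetherian : ~ H_left_noetherian alpha beta gamma.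
Proof.
have [lam [lam_i lam_gt lam_rec]] := weights.
by move/H_left_noetherianP; apply: (trunc_not_left_noetherian be_i lam_i lam_gt lam_rec (up := false)).
Qed.

Lemma not_poly_ring2 : ~ is_poly_ring2 alpha beta gamma i (qX k n0 i) (qY k n0 i).
Proof.
(* The polynomial [(Y - alpha X - gamma) X], nonzero by its coefficient at [X Y]; its value at
   vertex [i] is [annU X = 0]. *)
pose P : {poly {poly k}} := bimon 1 1 1 - bimon (at_vtx alpha i) 2 0 - bimon (at_vtx gamma i) 1 0.
case=> _ /(_ P); apply.
  apply/eqP => /(congr1 (fun P : {poly {poly k}} => (P`_1 : {poly k})`_1)).
  by rewrite /P !coefB !coef_bimon !coef0 !mulr0n !subr0 => /eqP; rewrite oner_eq0.
rewrite -[nat_of_ord i](vtx_nat (ltn_ord i)).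
have [F E] := cls_poly2_eval alpha beta gamma (i : nat) P.
apply/(cls_eq0 alpha beta gamma F).
rewrite E /P !evalXYB !evalXY_mon !monE.
rewrite scale1r !expr0 !mulr1 expr1 -[RHS](@annU_X k n0 alpha beta gamma i be_i) /annU.
rewrite -[RHS]mulrA; congr (_ * _).
by rewrite !mulrBl -!scalerAl mul1r expr2 (XY_comm DU).
Qed.

Lemma not_piecewise_domain : ~ H_piecewise_domain alpha beta gamma.
Proof.
have [lam [lam_i lam_gt lam_rec]] := weights.
set w := annU alpha beta gamma i => PD.
have Fe (v : 'I_n) : fin_supp n (qe k v) by apply: fin_supp_qbasis.
have ce (v : int) : cls (qe k (vord n0 v)) = he alpha beta gamma v by [].
have Fw : fin_supp n (hrep w) by apply: fin_hrep.
have FU : fin_supp n (hrep (hU alpha beta gamma)) by apply: fin_hrep.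
(* The zero divisors are [w], a loop at [i], and the arrow [e_i U] from [i] to [i + 1]. *)
have PDw := PD (vord n0 i) (vord n0 i) (vord n0 ((i : nat)%:Z + 1)) _ _ Fw FU.
have F1 := fin_suppM (Fe (vord n0 i)) (fin_suppM Fw (Fe (vord n0 i))).
have F2 := fin_suppM (Fe (vord n0 i)) (fin_suppM FU (Fe (vord n0 ((i : nat)%:Z + 1)))).
have G1 := fin_suppM Fw (Fe (vord n0 i)).
have G2 := fin_suppM FU (Fe (vord n0 ((i : nat)%:Z + 1))).
have E1 : cls (qmul n (qe k (vord n0 i)) (qmul n (hrep w) (qe k (vord n0 i)))) = w.
  rewrite (clsM _ _ _ (Fe _) G1) (clsM _ _ _ Fw (Fe _)) hrepK ce annU_e /w /annU.
  by rewrite mulrA he_mul eqxx.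
have E2 : cls (qmul n (qe k (vord n0 i)) (qmul n (hrep (hU alpha beta gamma))
    (qe k (vord n0 ((i : nat)%:Z + 1))))) = he alpha beta gamma i * hU alpha beta gamma.
  rewrite (clsM _ _ _ (Fe _) G2) (clsM _ _ _ FU (Fe _)) hrepK !ce.
  by rewrite -he_U mulrA he_mul eqxx.
cbv zeta in PDw; move: PDw.
rewrite -(cls_eq0 _ _ _ (fin_suppM F1 F2)) -(cls_eq0 _ _ _ F1) -(cls_eq0 _ _ _ F2).
rewrite (clsM _ _ _ F1 F2) E1 E2 mulrA annU_e (@annU_U k n0 alpha beta gamma i be_i) => /(_ erefl)[].
- exact: (annU_neq0 lam_i lam_gt lam_rec true).
- exact: (trunc_eU_neq0 lam_gt lam_rec (up := true)).
Qed.

End ZeroBeta.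
End Equivalences.

Theorem theorem4p2 (k : closedFieldType) (hk : [pchar k] =i pred0)
    (n : nat) (hn : (0 < n)%N) (alpha beta gamma : 'I_n -> k) :
  [<-> (forall i : 'I_n, beta i != 0);
       H_right_noetherian alpha beta gamma;
       H_left_noetherian alpha beta gamma;
       (forall i : 'I_n,
          is_poly_ring2 alpha beta gamma i
            (qmul n (qu k i) (qd k n i))
            (qmul n (qd k n (vdown n i)) (qu k (vdown n i))));
       H_piecewise_domain alpha beta gamma].
Proof.
case: n hn alpha beta gamma => // n0 _ alpha beta gamma.
have beta_of (P : Prop) : (forall i, beta i = 0 -> ~ P) -> P -> forall i, beta i != 0.
  by move=> nP HP i; apply/eqP => /nP.
have b2 := beta_of _ (@not_right_noetherian k n0 alpha beta gamma).
have b2' := beta_of _ (@not_left_noetherian k n0 alpha beta gamma).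
have b4 := beta_of _ (@not_piecewise_domain k n0 alpha beta gamma).
(* Each implication of the cycle passes through the nonvanishing of all [beta i]. *)
tfae.
- exact: right_noetherian_of_beta.
- by move/b2/left_noetherian_of_beta.
- by move/b2' => b0 i; apply: poly_ring2_of_beta.
- move=> P3; apply: piecewise_domain_of_beta => i; apply/eqP => bi0.
  exact: (not_poly_ring2 bi0 (P3 i)).
- exact: b4.
Qed.
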